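(* Let $A$ be a unital algebra over $\mathbb{C}$ with first order differential calculus $\Omega^1_A$, and let $M=C^\infty(\mathbb{R})\otimes A$ with the left $C^\infty(\mathbb{R})$-$A$-bimodule connection $$\nabla_M(c)=\mathrm{d}t\otimes\Big(bc+\frac{\partial c}{\partial t}+K(\mathrm{d}c)\Big),\qquad \sigma_M(1\otimes\xi)=\mathrm{d}t\otimes K(\xi),$$ where $b\in C^\infty(\mathbb{R})\otimes A$ and $K:\Omega^1_A\to C^\infty(\mathbb{R})\otimes A$ is a right $A$-module map (a time dependent vector field). Take the trivial connection on $\Omega^1(\mathbb{R})$, i.e. $\nabla_{\Omega^1(\mathbb{R})}(f\,\mathrm{d}t)=\mathrm{d}t\otimes\frac{\partial f}{\partial t}\mathrm{d}t$ and $\sigma_{\Omega^1(\mathbb{R})}(\mathrm{d}t\otimes\mathrm{d}t)=\mathrm{d}t\otimes\mathrm{d}t$, and a left bimodule connection $\nabla_{\Omega^1_A}$ on the $A$-bimodule $\Omega^1_A$ with invertible $\sigma_{\Omega^1_A}:\Omega^1_A\otimes_A\Omega^1_A\to\Omega^1_A\otimes_A\Omega^1_A$. Then $D(\sigma_M)=0$ if and only if both $$K(K\otimes\mathrm{id})\sigma_{\Omega^1_A}=K(K\otimes\mathrm{id})$$ and, for all $\xi\in\Omega^1_A$ (constant in time), $$\frac{\partial K(\xi)}{\partial t}=K(b\xi)-bK(\xi)+K(K\otimes\mathrm{id})\,\sigma_{\Omega^1_A}^{-1}\nabla_{\Omega^1_A}(\xi)-K(\mathrm{d}K(\xi)).\qquad(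 * )$$ Further, if $K$ satisfies $( * )$ for some $\xi\in\Omega^1_A$, then it also satisfies $( * )$ for $\xi\,a$ for all $a\in A$; so it is only necessary to verify $( * )$ for a collection of right generators of $\Omega^1_A$.
   Context: A first order differential calculus over $A$ is an $A$-bimodule $\Omega^1_A$ with a linear map $\mathrm{d}:A\to\Omega^1_A$ such that $\mathrm{d}(ab)=(\mathrm{d}a)b+a\,\mathrm{d}b$ and $\Omega^1_A=\mathrm{span}\{a\,\mathrm{d}b\}$. $C^\infty(\mathbb{R})$ (complex valued, coordinate $t$) has its usual calculus $\Omega^1(\mathbb{R})$. A left $B$-$A$-bimodule connection on a $B$-$A$-bimodule $M$ is a pair $(\nabla_M,\sigma_M)$ with $\nabla_M:M\to\Omega^1_B\otimes_B M$ linear satisfying $\nabla_M(b.m)=\mathrm{d}b\otimes m+b.\nabla_M(m)$, and $\sigma_M:M\otimes_A\Omega^1_A\to\Omega^1_B\otimes_B M$ a $B$-$A$-bimodule map with $\nabla_M(m.a)=\nabla_M(m).a+\sigma_M(m\otimes\mathrm{d}a)$. Tensor product connections are $\nabla_{Q\otimes M}(q\otimes m)=\nabla_Q q\otimes m+(\sigma_Q\otimes\mathrm{id})(q\otimes\nabla_M m)$, with $\sigma_{Q\otimes M}=(\sigma_Q\otimes\mathrm{id})(\mathrm{id}\otimes\sigma_M)$. The derivative of $\sigma_M$ is $$D(\sigma_M)=\nabla_{\Omega^1(\mathbb{R})\otimes M}\,\sigma_M-(\mathrm{id}\otimes\sigma_M)\nabla_{M\otimes\Omega^1_A}: M\otimes_A\Omega^1_A\to\Omega^1(\mathbb{R})\otimes_{C^\infty(\mathbb{R})}\Omega^1(\mathbb{R})\otimes_{C^\infty(\mathbb{R})}M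 .$$ $C^\infty(\mathbb{R})\otimes A$ is an algebra, with left action of $C^\infty(\mathbb{R})$ and right action of $A$ by multiplication. $\mathrm{d}$ acts on $C^\infty(\mathbb{R})\otimes A$ in the $A$ direction only, $\mathrm{d}(f\otimes a)=f\otimes\mathrm{d}a$. All maps such as $K$, $\mathrm{d}$, $\nabla_{\Omega^1_A}$, $\sigma_{\Omega^1_A}$ are extended $C^\infty(\mathbb{R})$-linearly, e.g. $K(f\otimes\xi)=fK(\xi)$. The notation $K(K\otimes\mathrm{id})$ means $\xi\otimes\eta\mapsto K(K(\xi)\eta)$. *)

(* Defs.v *)
From HB Require Import structures.
From mathcomp Require Import all_boot all_order all_algebra generic_quotient.
From mathcomp Require Import complex.
From mathcomp Require Import all_classical all_reals all_analysis.
From mathcomp Require Import ring.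

Set Implicit Arguments.
Unset Strict Implicit.
Unset Printing Implicit Defensive.

Import Order.TTheory GRing.Theory Num.Theory.
Import numFieldNormedType.Exports.

Local Open Scope ring_scope.
Local Open Scope quotient_scope.

#[local] Obligation Tactic := idtac.

Reserved Notation "b ▷ m" (at level 38, right associativity).
Reserved Notation "m ◁ a" (at level 37, left associativity).
Reserved Notation "m ⊗ n" (at level 39, left associativity).
Reserved Notation "f ⊡ x" (at level 39, left associativity).
Reserved Notation "B ⊠ X" (at level 39, left associativity).
Reserved Notation "u ∙ y" (at level 39, left associativity).
Reserved Notation "M ⨂ N" (at level 39, left associativity).

Record bimod (k : comNzRingType) (B A : algType k) := Bimod {
  bimod_sort :> lmodType k;
  lact : B -> bimod_sort -> bimod_sort;
  ract : bimod_sort -> A -> bimod_sort;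
  lactDl : forall b b' m, lact (b + b') m = lact b m + lact b' m;
  lactDr : forall b m m', lact b (m + m') = lact b m + lact b m';
  lactZl : forall c b m, lact (c *: b) m = c *: lact b m;
  lactZr : forall c b m, lact b (c *: m) = c *: lact b m;
  lact1 : forall m, lact 1 m = m;
  lactA : forall b b' m, lact (b * b') m = lact b (lact b' m);
  ractDl : forall m m' a, ract (m + m') a = ract m a + ract m' a;
  ractDr : forall m a a', ract m (a + a') = ract m a + ract m a';
  ractZl : forall c m a, ract (c *: m) a = c *: ract m a;
  ractZr : forall c m a, ract m (c *: a) = c *: ract m a;
  ract1 : forall m, ract m 1 = m;
  ractA : forall m a a', ract m (a * a') = ract (ract m a) a';
  lractA : forall b m a, lact b (ract m a) = ract (lact b m) a
}.

Arguments lact {k B A M} b m : rename.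
Arguments ract {k B A M} m a : rename.

Notation "b ▷ m" := (lact b m) : ring_scope.
Notation "m ◁ a" := (ract m a) : ring_scope.

Section BimodTheory.
Variables (k : comNzRingType) (B A : algType k) (M : bimod B A).

Lemma lact_sumr I (r : seq I) (F : I -> M) (b : B) :
  b ▷ (\sum_(i <- r) F i) = \sum_(i <- r) b ▷ F i.
Proof.
apply: (big_morph (fun m : M => b ▷ m)) => [x y|]; first exact: lactDr.
by rewrite -(scale0r (0 : M)) lactZr !scale0r.
Qed.

Lemma ract_suml I (r : seq I) (F : I -> M) (a : A) :
  (\sum_(i <- r) F i) ◁ a = \sum_(i <- r) F i ◁ a.
Proof.
apply: (big_morph (fun m : M => m ◁ a)) => [x y|]; first exact: ractDl.
by rewrite -(scale0r (0 : M)) ractZl !scale0r.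
Qed.

End BimodTheory.

Record bimod_map (k : comNzRingType) (B A : algType k) (M N : bimod B A) :=
  BimodMap {
    bimod_fun :> {linear M -> N};
    bimod_funl : forall (b : B) (m : M), bimod_fun (b ▷ m) = b ▷ bimod_fun m;
    bimod_funr : forall (m : M) (a : A), bimod_fun (m ◁ a) = bimod_fun m ◁ a
  }.

Record rmod_map (k : comNzRingType) (B B' A : algType k)
    (M : bimod B A) (N : bimod B' A) := RmodMap {
  rmod_fun :> {linear M -> N};
  rmod_funr : forall (m : M) (a : A), rmod_fun (m ◁ a) = rmod_fun m ◁ a
}.

Section BasicBimodules.
Variables (k : comNzRingType).

Program Definition regbimod (A : algType k) : bimod A A :=
  @Bimod k A A A (fun b m => b * m) (fun m a => m * a)
    _ _ _ _ _ _ _ _ _ _ _ _ _.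
Next Obligation. cbv beta; by move=> *; rewrite mulrDl. Qed.
Next Obligation. cbv beta; by move=> *; rewrite mulrDr. Qed.
Next Obligation. cbv beta; by move=> *; rewrite scalerAl. Qed.
Next Obligation. cbv beta; by move=> *; rewrite scalerAr. Qed.
Next Obligation. cbv beta; by move=> *; rewrite mul1r. Qed.
Next Obligation. cbv beta; by move=> *; rewrite mulrA. Qed.
Next Obligation. cbv beta; by move=> *; rewrite mulrDl. Qed.
Next Obligation. cbv beta; by move=> *; rewrite mulrDr. Qed.
Next Obligation. cbv beta; by move=> *; rewrite scalerAl. Qed.
Next Obligation. cbv beta; by move=> *; rewrite scalerAr. Qed.
Next Obligation. cbv beta; by move=> *; rewrite mulr1. Qed.
Next Obligation. cbv beta; by move=> *; rewrite mulrA. Qed.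
Next Obligation. cbv beta; by move=> *; rewrite mulrA. Qed.

End BasicBimodules.

Section Tensor.
Variables (k : comNzRingType) (B A E : algType k).
Variables (M : bimod B A) (N : bimod A E).

(* A list of pairs stands for the formal sum of its elementary tensors. No
   clause for the scalars of k is needed: k acts through A. *)
Inductive tens_rel : seq (M * N) -> seq (M * N) -> Prop :=
| TRrefl s : tens_rel s s
| TRsym s t : tens_rel s t -> tens_rel t s
| TRtrans s t u : tens_rel s t -> tens_rel t u -> tens_rel s u
| TRcat s s' t t' : tens_rel s s' -> tens_rel t t' ->
    tens_rel (s ++ t) (s' ++ t')
| TRcomm s t : tens_rel (s ++ t) (t ++ s)
| TRzero n : tens_rel [:: (0, n)] [::]
| TRaddl m m' n : tens_rel [:: (m + m', n)] [:: (m, n); (m', n)]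
| TRaddr m n n' : tens_rel [:: (m, n + n')] [:: (m, n); (m, n')]
| TRbal m a n : tens_rel [:: (m ◁ a, n)] [:: (m, a ▷ n)].

Definition tens_relb s t : bool := `[< tens_rel s t >].

Lemma tens_relb_refl : reflexive tens_relb.
Proof. by move=> s; apply/asboolP; exact: TRrefl. Qed.
Lemma tens_relb_sym : symmetric tens_relb.
Proof. by move=> s t; apply/asboolP/asboolP => /TRsym. Qed.
Lemma tens_relb_trans : transitive tens_relb.
Proof.
by move=> t s u /asboolP st /asboolP tu; apply/asboolP; exact: TRtrans st tu.
Qed.

Definition tens_equiv :=
  EquivRel tens_relb tens_relb_refl tens_relb_sym tens_relb_trans.

Definition tens_sort := {eq_quot tens_equiv}.
HB.instance Definition _ := Choice.on tens_sort.

Definition tens_of (s : seq (M * N)) : tens_sort := \pi_({eq_quot tens_equiv}) s.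
Definition tens_repr (x : tens_sort) : seq (M * N) :=
  @repr _ {eq_quot tens_equiv} x.

Lemma tens_reprK x : tens_of (tens_repr x) = x.
Proof. exact: reprK. Qed.

Lemma tens_ofP s t : tens_of s = tens_of t <-> tens_rel s t.
Proof.
split; first by move=> /(@eqmodP _ tens_equiv) /asboolP.
by move=> st; apply/(@eqmodP _ tens_equiv)/asboolP.
Qed.

Lemma tens_repr_of s : tens_rel (tens_repr (tens_of s)) s.
Proof. by apply/tens_ofP; rewrite tens_reprK. Qed.

Lemma tens_rel_mapl (F : M -> M) s t :
  (forall m m', F (m + m') = F m + F m') -> F 0 = 0 ->
  (forall m (a : A), F (m ◁ a) = F m ◁ a) ->
  tens_rel s t ->
  tens_rel [seq (F p.1, p.2) | p <- s] [seq (F p.1, p.2) | p <- t].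
Proof.
move=> FD F0 Fr; elim=> {s t} /=.
- by move=> *; exact: TRrefl.
- by move=> *; exact: TRsym.
- by move=> s t u _ st _ tu; exact: TRtrans st tu.
- by move=> s s' t t' _ ss _ tt; rewrite !map_cat; exact: TRcat.
- by move=> s t; rewrite !map_cat; exact: TRcomm.
- by move=> n; rewrite F0; exact: TRzero.
- by move=> m m' n; rewrite FD; exact: TRaddl.
- by move=> *; exact: TRaddr.
- by move=> *; rewrite Fr; exact: TRbal.
Qed.

Lemma tens_rel_mapr (G : N -> N) s t :
  (forall n n', G (n + n') = G n + G n') ->
  (forall (a : A) n, G (a ▷ n) = a ▷ G n) ->
  tens_rel s t ->
  tens_rel [seq (p.1, G p.2) | p <- s] [seq (p.1, G p.2) | p <- t].
Proof.
move=> GD Gl; elim=> {s t} /=.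
- by move=> *; exact: TRrefl.
- by move=> *; exact: TRsym.
- by move=> s t u _ st _ tu; exact: TRtrans st tu.
- by move=> s s' t t' _ ss _ tt; rewrite !map_cat; exact: TRcat.
- by move=> s t; rewrite !map_cat; exact: TRcomm.
- by move=> *; exact: TRzero.
- by move=> *; exact: TRaddl.
- by move=> *; rewrite GD; exact: TRaddr.
- by move=> *; rewrite Gl; exact: TRbal.
Qed.

Definition tens_add (x y : tens_sort) := tens_of (tens_repr x ++ tens_repr y).
Definition tens_scale (c : k) (x : tens_sort) :=
  tens_of [seq (c *: p.1, p.2) | p <- tens_repr x].
Definition tens_opp (x : tens_sort) :=
  tens_of [seq (- p.1, p.2) | p <- tens_repr x].

Let lact0 (b : B) : b ▷ (0 : M) = 0.
Proof. by have := lact_sumr [::] (fun i : nat => 0 : M) b; rewrite !big_nil. Qed.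
Let ract0 (a : A) : (0 : M) ◁ a = 0.
Proof. by have := ract_suml [::] (fun i : nat => 0 : M) a; rewrite !big_nil. Qed.

Lemma tens_addE s t : tens_add (tens_of s) (tens_of t) = tens_of (s ++ t).
Proof. by apply/tens_ofP/TRcat; exact: tens_repr_of. Qed.

Lemma tens_scaleE c s :
  tens_scale c (tens_of s) = tens_of [seq (c *: p.1, p.2) | p <- s].
Proof.
apply/tens_ofP; apply: tens_rel_mapl (tens_repr_of s).
- by move=> *; rewrite scalerDr.
- by rewrite scaler0.
- by move=> *; rewrite ractZl.
Qed.

Lemma tens_oppE s : tens_opp (tens_of s) = tens_of [seq (- p.1, p.2) | p <- s].
Proof.
apply/tens_ofP; apply: tens_rel_mapl (tens_repr_of s).
- by move=> *; rewrite opprD.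
- by rewrite oppr0.
- by move=> m a; rewrite -!scaleN1r ractZl.
Qed.

Lemma tens_sortW (P : tens_sort -> Prop) :
  (forall s, P (tens_of s)) -> forall x, P x.
Proof. by move=> Ps x; rewrite -(tens_reprK x). Qed.

Fact tens_addA : associative tens_add.
Proof.
elim/tens_sortW=> s; elim/tens_sortW=> t; elim/tens_sortW=> u.
by rewrite !tens_addE catA.
Qed.
Fact tens_addC : commutative tens_add.
Proof.
elim/tens_sortW=> s; elim/tens_sortW=> t.
by rewrite !tens_addE; apply/tens_ofP; exact: TRcomm.
Qed.
Fact tens_add0 : left_id (tens_of [::]) tens_add.
Proof. by elim/tens_sortW=> s; rewrite tens_addE. Qed.
Fact tens_addN : left_inverse (tens_of [::]) tens_opp tens_add.
Proof.
elim/tens_sortW=> s; rewrite tens_oppE tens_addE; apply/tens_ofP.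
elim: s => [|[m n] s IHs] /=; first exact: TRrefl.
have h : tens_rel [:: (- m, n); (m, n)] [::].
  apply: TRtrans (TRzero n); apply: TRsym; rewrite -(addNr m); exact: TRaddl.
apply: TRtrans (TRcat h IHs); rewrite /= -cat1s -[X in tens_rel _ X]cat1s.
apply: TRcat; first exact: TRrefl.
rewrite -cat1s catA -[X in tens_rel _ X]cat1s catA.
by apply: TRcat; [exact: TRcomm|exact: TRrefl].
Qed.

HB.instance Definition _ :=
  GRing.isZmodule.Build tens_sort tens_addA tens_addC tens_add0 tens_addN.

Definition pure (m : M) (n : N) : tens_sort := tens_of [:: (m, n)].

Lemma tens_ofE s : tens_of s = \sum_(p <- s) pure p.1 p.2.
Proof.
elim: s => [|[m n] s IHs]; first by rewrite big_nil.
by rewrite big_cons -IHs; symmetry; apply: tens_addE.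
Qed.

Fact tens_scaleDl' x : {morph tens_scale^~ x : a b / a + b}.
Proof.
elim/tens_sortW: x => s a b; rewrite !tens_scaleE.
rewrite !tens_ofE -[LHS]/(_) !big_map -big_split; apply: eq_bigr => p _ /=.
rewrite scalerDl; symmetry; rewrite /pure; etransitivity; first exact: tens_addE.
by apply/tens_ofP/TRsym; exact: TRaddl.
Qed.
Fact tens_scaleDr' : right_distributive tens_scale +%R.
Proof.
move=> c; elim/tens_sortW=> s; elim/tens_sortW=> t.
by rewrite -[_ + _ in LHS]/(tens_add _ _) -[RHS]/(tens_add _ _) tens_addE
  !tens_scaleE map_cat tens_addE.
Qed.
Fact tens_scaleA a b x : tens_scale a (tens_scale b x) = tens_scale (a * b) x.
Proof.
elim/tens_sortW: x => s; rewrite !tens_scaleE -map_comp.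
by congr tens_of; apply: eq_map => p /=; rewrite scalerA.
Qed.
Fact tens_scale1 : left_id 1 tens_scale.
Proof.
elim/tens_sortW=> s; rewrite tens_scaleE -[in RHS](map_id s).
by congr tens_of; apply: eq_map => -[m n] /=; rewrite scale1r.
Qed.

HB.instance Definition _ := GRing.Zmodule_isLmodule.Build k tens_sort
  tens_scaleA tens_scale1 tens_scaleDr' tens_scaleDl'.

Lemma pureDl m m' n : pure (m + m') n = pure m n + pure m' n.
Proof.
rewrite /pure; symmetry; etransitivity; first exact: tens_addE.
by apply/tens_ofP/TRsym; exact: TRaddl.
Qed.
Lemma pureDr m n n' : pure m (n + n') = pure m n + pure m n'.
Proof.
rewrite /pure; symmetry; etransitivity; first exact: tens_addE.
by apply/tens_ofP/TRsym; exact: TRaddr.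
Qed.
Lemma pure_bal m (a : A) n : pure (m ◁ a) n = pure m (a ▷ n).
Proof. by apply/tens_ofP; exact: TRbal. Qed.
Lemma pureZl c m n : pure (c *: m) n = c *: pure m n.
Proof. by rewrite -[RHS]/(tens_scale _ _) tens_scaleE. Qed.
Lemma pureZr c m n : pure m (c *: n) = c *: pure m n.
Proof.
rewrite -pureZl -[n in LHS]lact1 -lactZl -pure_bal ractZr.
by rewrite ract1.
Qed.

Lemma tens_sum_pure x : exists s : seq (M * N), x = \sum_(p <- s) pure p.1 p.2.
Proof. by exists (tens_repr x); rewrite -tens_ofE tens_reprK. Qed.

Lemma tens_ind_pure (P : tens_sort -> Prop) :
  (forall m n, P (pure m n)) -> (forall x y, P x -> P y -> P (x + y)) ->
  forall x, P x.
Proof.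
move=> Pt PD x; have [s ->] := tens_sum_pure x; elim: s => [|p s IHs].
  rewrite big_nil; have := Pt 0 0.
  by rewrite -(scale0r (0 : M)) pureZl scale0r.
by rewrite big_cons; apply: PD.
Qed.

Record balanced (V : lmodType k) := Balanced {
  bal_fun :> M -> N -> V;
  balDl : forall m m' n, bal_fun (m + m') n = bal_fun m n + bal_fun m' n;
  balDr : forall m n n', bal_fun m (n + n') = bal_fun m n + bal_fun m n';
  balZl : forall c m n, bal_fun (c *: m) n = c *: bal_fun m n;
  balA : forall m (a : A) n, bal_fun (m ◁ a) n = bal_fun m (a ▷ n)
}.

Section Lift.
Variables (V : lmodType k) (f : balanced V).

Definition lift_fun (x : tens_sort) : V :=
  \sum_(p <- tens_repr x) f p.1 p.2.

Let lift_of s : lift_fun (tens_of s) = \sum_(p <- s) f p.1 p.2.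
Proof.
have H u t : tens_rel u t ->
    \sum_(p <- u) f p.1 p.2 = \sum_(p <- t) f p.1 p.2.
  elim=> {u t} //.
  - by move=> u t w _ -> _ ->.
  - by move=> u u' t t' _ uu _ tt; rewrite !big_cat /= uu tt.
  - by move=> u t; rewrite !big_cat /= addrC.
  - by move=> n; rewrite big_cons !big_nil addr0 -(scale0r (0 : M)) balZl scale0r.
  - by move=> m m' n; rewrite !big_cons !big_nil !addr0 balDl.
  - by move=> m n n'; rewrite !big_cons !big_nil !addr0 balDr.
  - by move=> m a n; rewrite !big_seq1 /= balA.
exact: H (tens_repr_of s).
Qed.

Fact lift_linear : linear lift_fun.
Proof.
move=> c; elim/tens_sortW=> s; elim/tens_sortW=> t.
have -> : c *: tens_of s + tens_of t =
    tens_of ([seq (c *: p.1, p.2) | p <- s] ++ t).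
  by rewrite -[LHS]/(tens_add (tens_scale _ _) _) tens_scaleE tens_addE.
rewrite !lift_of big_cat /= big_map scaler_sumr; congr (_ + _).
by apply: eq_bigr => p _ /=; rewrite balZl.
Qed.

HB.instance Definition _ := GRing.isLinear.Build k tens_sort V _ lift_fun
  lift_linear.

Definition lift : {linear tens_sort -> V} := lift_fun.

Lemma lift_pure m n : lift (pure m n) = f m n.
Proof. by rewrite /lift /= lift_of big_seq1. Qed.

End Lift.


Program Definition tens_lact (b : B) : {linear tens_sort -> tens_sort} :=
  lift (@Balanced _ (fun m n => pure (b ▷ m) n) _ _ _ _).
Next Obligation. cbv beta; by move=> *; rewrite lactDr pureDl. Qed.
Next Obligation. cbv beta; by move=> *; rewrite pureDr. Qed.
Next Obligation. cbv beta; by move=> *; rewrite lactZr pureZl. Qed.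
Next Obligation. cbv beta; by move=> *; rewrite lractA pure_bal. Qed.

Program Definition tens_ract (e : E) : {linear tens_sort -> tens_sort} :=
  lift (@Balanced _ (fun m n => pure m (n ◁ e)) _ _ _ _).
Next Obligation. cbv beta; by move=> *; rewrite pureDl. Qed.
Next Obligation. cbv beta; by move=> *; rewrite ractDl pureDr. Qed.
Next Obligation. cbv beta; by move=> *; rewrite pureZl. Qed.
Next Obligation. cbv beta; by move=> *; rewrite pure_bal lractA. Qed.

Lemma tens_lactE b m n : tens_lact b (pure m n) = pure (b ▷ m) n.
Proof. exact: lift_pure. Qed.
Lemma tens_ractE e m n : tens_ract e (pure m n) = pure m (n ◁ e).
Proof. exact: lift_pure. Qed.

Program Definition tens : bimod B E :=
  @Bimod k B E tens_sort (fun b x => tens_lact b x) (fun x e => tens_ract e x)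
    _ _ _ _ _ _ _ _ _ _ _ _ _.
Next Obligation.
cbv beta; move=> b b'; elim/tens_ind_pure => [m n|x y IHx IHy].
  by rewrite !tens_lactE lactDl pureDl.
by rewrite !linearD IHx IHy addrACA.
Qed.
Next Obligation. cbv beta; by move=> *; rewrite linearD. Qed.
Next Obligation.
cbv beta; move=> c b; elim/tens_ind_pure => [m n|x y IHx IHy].
  by rewrite !tens_lactE lactZl pureZl.
by rewrite !linearD IHx IHy.
Qed.
Next Obligation. cbv beta; by move=> *; rewrite linearZ. Qed.
Next Obligation.
cbv beta; elim/tens_ind_pure => [m n|x y IHx IHy]; first by rewrite tens_lactE lact1.
by rewrite linearD IHx IHy.
Qed.
Next Obligation.
cbv beta; move=> b b'; elim/tens_ind_pure => [m n|x y IHx IHy].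
  by rewrite !tens_lactE lactA.
by rewrite !linearD IHx IHy.
Qed.
Next Obligation. cbv beta; by move=> *; rewrite linearD. Qed.
Next Obligation.
cbv beta; move=> + e e'; elim/tens_ind_pure => [m n|x y IHx IHy].
  by rewrite !tens_ractE ractDr pureDr.
by rewrite !linearD IHx IHy addrACA.
Qed.
Next Obligation. cbv beta; by move=> *; rewrite linearZ. Qed.
Next Obligation.
cbv beta; move=> c + e; elim/tens_ind_pure => [m n|x y IHx IHy].
  by rewrite !tens_ractE ractZr pureZr.
by rewrite !linearD IHx IHy.
Qed.
Next Obligation.
cbv beta; elim/tens_ind_pure => [m n|x y IHx IHy]; first by rewrite tens_ractE ract1.
by rewrite linearD IHx IHy.
Qed.
Next Obligation.
cbv beta; move=> + e e'; elim/tens_ind_pure => [m n|x y IHx IHy].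
  by rewrite !tens_ractE ractA.
by rewrite !linearD IHx IHy.
Qed.
Next Obligation.
cbv beta; move=> b + e; elim/tens_ind_pure => [m n|x y IHx IHy].
  by rewrite tens_lactE !tens_ractE tens_lactE.
by rewrite !linearD IHx IHy.
Qed.

Definition ten (m : M) (n : N) : tens := pure m n.

Lemma tenDl m m' n : ten (m + m') n = ten m n + ten m' n.
Proof. exact: pureDl. Qed.
Lemma tenDr m n n' : ten m (n + n') = ten m n + ten m n'.
Proof. exact: pureDr. Qed.
Lemma tenZl c m n : ten (c *: m) n = c *: ten m n.
Proof. exact: pureZl. Qed.
Lemma tenZr c m n : ten m (c *: n) = c *: ten m n.
Proof. exact: pureZr. Qed.
Lemma ten_bal m (a : A) n : ten (m ◁ a) n = ten m (a ▷ n).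
Proof. exact: pure_bal. Qed.
Lemma lact_ten (b : B) m n : b ▷ ten m n = ten (b ▷ m) n.
Proof. exact: tens_lactE. Qed.
Lemma ract_ten m n (e : E) : ten m n ◁ e = ten m (n ◁ e).
Proof. exact: tens_ractE. Qed.

Lemma tens_sum (x : tens) :
  exists s : seq (M * N), x = \sum_(p <- s) ten p.1 p.2.
Proof. exact: tens_sum_pure. Qed.

Lemma tens_ind (P : tens -> Prop) :
  (forall m n, P (ten m n)) -> (forall x y, P x -> P y -> P (x + y)) ->
  forall x, P x.
Proof. exact: tens_ind_pure. Qed.

Definition tlift (V : lmodType k) (f : balanced V) : {linear tens -> V} :=
  lift f.

Lemma tlift_ten (V : lmodType k) (f : balanced V) m n :
  tlift f (ten m n) = f m n.
Proof. exact: lift_pure. Qed.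

Lemma tens_ext (V : lmodType k) (g h : {linear tens -> V}) :
  (forall m n, g (ten m n) = h (ten m n)) -> g =1 h.
Proof. by move=> gh; elim/tens_ind => // x y gx gy; rewrite !linearD gx gy. Qed.

End Tensor.

Arguments tens : simpl never.
Arguments ten : simpl never.
Arguments tlift : simpl never.
Arguments ten {k B A E M N} m n.

Notation "M ⨂ N" := (tens M N) : ring_scope.
Notation "m ⊗ n" := (ten m n) : ring_scope.

Section TensorMaps.
Variables (k : comNzRingType).

Section TMap.
Variables (B A E : algType k) (M M' : bimod B A) (N N' : bimod A E).
Variables (f : bimod_map M M') (g : bimod_map N N').

Program Definition tmap_lin : {linear M ⨂ N -> M' ⨂ N'} :=
  tlift (@Balanced _ _ _ _ M N _ (fun m n => f m ⊗ g n : M' ⨂ N') _ _ _ _).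
Next Obligation. cbv beta; by move=> *; rewrite linearD tenDl. Qed.
Next Obligation. cbv beta; by move=> *; rewrite linearD tenDr. Qed.
Next Obligation. cbv beta; by move=> *; rewrite linearZ tenZl. Qed.
Next Obligation. cbv beta; by move=> *; rewrite bimod_funr ten_bal bimod_funl. Qed.

Let tmap_linE m n : tmap_lin (m ⊗ n) = f m ⊗ g n.
Proof. exact: tlift_ten. Qed.

Program Definition tmap : bimod_map (M ⨂ N) (M' ⨂ N') :=
  @BimodMap _ _ _ _ _ tmap_lin _ _.
Next Obligation.
cbv beta; move=> b; elim/tens_ind => [m n|x y IHx IHy].
  by rewrite lact_ten !tmap_linE bimod_funl lact_ten.
by rewrite lactDr !linearD lactDr IHx IHy.
Qed.
Next Obligation.
cbv beta; move=> + e; elim/tens_ind => [m n|x y IHx IHy].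
  by rewrite ract_ten !tmap_linE bimod_funr ract_ten.
by rewrite ractDl !linearD ractDl IHx IHy.
Qed.

Lemma tmap_ten m n : tmap (m ⊗ n) = f m ⊗ g n.
Proof. exact: tlift_ten. Qed.
End TMap.

End TensorMaps.

Section BimodId.
Variables (k : comNzRingType) (B A : algType k) (M : bimod B A).

Definition bimod_id : bimod_map M M :=
  @BimodMap k B A M M idfun (fun b m => erefl) (fun m a => erefl).

End BimodId.

Section Assoc.
Variables (k : comNzRingType) (F B A E : algType k).
Variables (L : bimod F B) (M : bimod B A) (N : bimod A E).

Program Definition tassoc1 (n : N) : {linear L ⨂ M -> L ⨂ (M ⨂ N)} :=
  tlift (@Balanced _ _ _ _ L M _ (fun l m => l ⊗ (m ⊗ n) : L ⨂ (M ⨂ N))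
    _ _ _ _).
Next Obligation. cbv beta; by move=> *; rewrite tenDl. Qed.
Next Obligation. cbv beta; by move=> *; rewrite tenDl tenDr. Qed.
Next Obligation. cbv beta; by move=> *; rewrite tenZl. Qed.
Next Obligation. cbv beta; by move=> *; rewrite ten_bal lact_ten. Qed.

Let tassoc1E n l m : tassoc1 n (l ⊗ m) = l ⊗ (m ⊗ n).
Proof. exact: tlift_ten. Qed.

Program Definition tassoc : {linear (L ⨂ M) ⨂ N -> L ⨂ (M ⨂ N)} :=
  tlift (@Balanced _ _ _ _ (L ⨂ M) N _ (fun x n => tassoc1 n x) _ _ _ _).
Next Obligation. cbv beta; by move=> *; rewrite linearD. Qed.
Next Obligation.
cbv beta; move=> + n n'; elim/tens_ind => [l m|x y IHx IHy].
  by rewrite !tassoc1E !tenDr.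
by rewrite !linearD IHx IHy addrACA.
Qed.
Next Obligation. cbv beta; by move=> *; rewrite linearZ. Qed.
Next Obligation.
cbv beta; move=> + a n; elim/tens_ind => [l m|x y IHx IHy].
  by rewrite ract_ten !tassoc1E ten_bal.
by rewrite ractDl !linearD IHx IHy.
Qed.

Lemma tassocE l m n : tassoc ((l ⊗ m) ⊗ n) = l ⊗ (m ⊗ n).
Proof. by rewrite /tassoc tlift_ten; exact: tassoc1E. Qed.

Program Definition tunassoc1 (l : L) : {linear M ⨂ N -> (L ⨂ M) ⨂ N} :=
  tlift (@Balanced _ _ _ _ M N _ (fun m n => (l ⊗ m) ⊗ n : (L ⨂ M) ⨂ N)
    _ _ _ _).
Next Obligation. cbv beta; by move=> *; rewrite tenDr tenDl. Qed.
Next Obligation. cbv beta; by move=> *; rewrite tenDr. Qed.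
Next Obligation. cbv beta; by move=> *; rewrite tenZr tenZl. Qed.
Next Obligation. cbv beta; by move=> *; rewrite -ten_bal ract_ten. Qed.

Let tunassoc1E l m n : tunassoc1 l (m ⊗ n) = (l ⊗ m) ⊗ n.
Proof. exact: tlift_ten. Qed.

Program Definition tunassoc : {linear L ⨂ (M ⨂ N) -> (L ⨂ M) ⨂ N} :=
  tlift (@Balanced _ _ _ _ L (M ⨂ N) _ (fun l y => tunassoc1 l y) _ _ _ _).
Next Obligation.
cbv beta; move=> l l'; elim/tens_ind => [m n|x y IHx IHy].
  by rewrite !tunassoc1E !tenDl.
by rewrite !linearD IHx IHy addrACA.
Qed.
Next Obligation. cbv beta; by move=> *; rewrite linearD. Qed.
Next Obligation.
cbv beta; move=> c l; elim/tens_ind => [m n|x y IHx IHy].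
  by rewrite !tunassoc1E !tenZl.
by rewrite !linearD IHx IHy.
Qed.
Next Obligation.
cbv beta; move=> l b; elim/tens_ind => [m n|x y IHx IHy].
  by rewrite lact_ten !tunassoc1E ten_bal.
by rewrite lactDr !linearD IHx IHy.
Qed.

Lemma tunassocE l m n : tunassoc (l ⊗ (m ⊗ n)) = (l ⊗ m) ⊗ n.
Proof. by rewrite /tunassoc tlift_ten; exact: tunassoc1E. Qed.

End Assoc.

Record fodc (k : comNzRingType) (A : algType k) := Fodc {
  fodc_forms :> bimod A A;
  fodc_d : {linear A -> fodc_forms};
  fodc_leibniz : forall a b : A,
    fodc_d (a * b) = fodc_d a ◁ b + a ▷ fodc_d b;
  fodc_span : forall w : fodc_forms,
    exists s : seq (A * A), w = \sum_(p <- s) p.1 ▷ fodc_d p.2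
}.

Notation "'d[' Om ] a" := (fodc_d Om a)
  (at level 10, a at next level, format "'d[' Om ]  a") : ring_scope.

Record lbconn (k : comNzRingType) (B A : algType k) (OmB : fodc B)
    (OmA : fodc A) (M : bimod B A) := Lbconn {
  nabla : {linear M -> OmB ⨂ M};
  sigma : bimod_map (M ⨂ OmA) (OmB ⨂ M);
  nabla_lact : forall (b : B) (m : M),
    nabla (b ▷ m) = d[OmB] b ⊗ m + b ▷ nabla m;
  nabla_ract : forall (m : M) (a : A),
    nabla (m ◁ a) = nabla m ◁ a + sigma (m ⊗ d[OmA] a)
}.

Section TensorConnection.
Variables (k : comNzRingType) (F B A : algType k).
Variables (OmF : fodc F) (OmB : fodc B) (OmA : fodc A).
Variables (Q : bimod F B) (M : bimod B A).
Variables (cQ : lbconn OmF OmB Q) (cM : lbconn OmB OmA M).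

(* sigma_Q ⊗ id, with the associativity isomorphisms made explicit *)
Definition sigma_tens_id (x : Q ⨂ (OmB ⨂ M)) : OmF ⨂ (Q ⨂ M) :=
  tassoc OmF Q M (tmap (sigma cQ) (bimod_id M) (tunassoc Q OmB M x)).

Fact sigma_tens_id_linear : linear sigma_tens_id.
Proof. by move=> c x y; rewrite /sigma_tens_id !linearP. Qed.
HB.instance Definition _ := GRing.isLinear.Build k (Q ⨂ (OmB ⨂ M))
  (OmF ⨂ (Q ⨂ M)) _ sigma_tens_id sigma_tens_id_linear.

Lemma sigma_tens_idE q w m :
  sigma_tens_id (q ⊗ (w ⊗ m)) = tassoc OmF Q M (sigma cQ (q ⊗ w) ⊗ m).
Proof. by rewrite /sigma_tens_id tunassocE tmap_ten. Qed.

Program Definition nabla_tens : {linear Q ⨂ M -> OmF ⨂ (Q ⨂ M)} :=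
  tlift (@Balanced _ _ _ _ Q M _
    (fun q m => tassoc OmF Q M (nabla cQ q ⊗ m)
                + sigma_tens_id (q ⊗ nabla cM m)) _ _ _ _).
Next Obligation.
by cbv beta => q q' m; rewrite linearD !tenDl !linearD addrACA.
Qed.
Next Obligation.
by cbv beta => q m m'; rewrite linearD !tenDr !linearD addrACA.
Qed.
Next Obligation.
by cbv beta => c q m; rewrite linearZ !tenZl !linearZ scalerDr.
Qed.
Next Obligation.
cbv beta => q b m; rewrite nabla_ract nabla_lact tenDl linearD /= tenDr linearD.
by rewrite /= !ten_bal sigma_tens_idE addrA.
Qed.

Lemma nabla_tensE q m :
  nabla_tens (q ⊗ m) =
  tassoc OmF Q M (nabla cQ q ⊗ m) + sigma_tens_id (q ⊗ nabla cM m).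
Proof. exact: tlift_ten. Qed.

End TensorConnection.

Section DerivativeOfSigma.
Variables (k : comNzRingType) (B A : algType k) (OmB : fodc B) (OmA : fodc A).
Variables (M : bimod B A).
Variables (cB : lbconn OmB OmB OmB) (cA : lbconn OmA OmA OmA).
Variables (cM : lbconn OmB OmA M).

(* D(sigma_M), with the target bracketed as OmB ⊗ (OmB ⊗ M) *)
Definition Dsigma (x : M ⨂ OmA) : OmB ⨂ (OmB ⨂ M) :=
  nabla_tens cB cM (sigma cM x)
  - tmap (bimod_id OmB) (sigma cM) (nabla_tens cM cA x).

End DerivativeOfSigma.

Section ScalarTensor.
Variables (k : comNzRingType).

(* B as a B-k-bimodule, so that tensor products over k^o are those over k *)
Program Definition algbimod (B : algType k) : bimod B k^o :=
  @Bimod k B k^o B (fun b m => b * m) (fun m (c : k) => c *: m)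
    _ _ _ _ _ _ _ _ _ _ _ _ _.
Next Obligation. cbv beta; by move=> *; rewrite mulrDl. Qed.
Next Obligation. cbv beta; by move=> *; rewrite mulrDr. Qed.
Next Obligation. cbv beta; by move=> *; rewrite scalerAl. Qed.
Next Obligation. cbv beta; by move=> *; rewrite scalerAr. Qed.
Next Obligation. cbv beta; by move=> *; rewrite mul1r. Qed.
Next Obligation. cbv beta; by move=> *; rewrite mulrA. Qed.
Next Obligation. cbv beta; by move=> *; rewrite scalerDr. Qed.
Next Obligation. cbv beta; by move=> *; rewrite scalerDl. Qed.
Next Obligation. cbv beta; by move=> *; rewrite !scalerA mulrC. Qed.
Next Obligation. cbv beta; by move=> *; rewrite scalerA. Qed.
Next Obligation. cbv beta; by move=> *; rewrite scale1r. Qed.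
Next Obligation. cbv beta; by move=> *; rewrite scalerA mulrC. Qed.
Next Obligation. cbv beta; by move=> *; rewrite scalerAr. Qed.

(* Restriction of the left action to the scalars k *)
Program Definition rightmod (B A : algType k) (X : bimod B A) : bimod k^o A :=
  @Bimod k k^o A X (fun (c : k) m => c *: m) (fun m a => m ◁ a)
    _ _ _ _ _ _ _ _ _ _ _ _ _.
Next Obligation. cbv beta; by move=> *; rewrite scalerDl. Qed.
Next Obligation. cbv beta; by move=> *; rewrite scalerDr. Qed.
Next Obligation. cbv beta; by move=> *; rewrite scalerA. Qed.
Next Obligation. cbv beta; by move=> *; rewrite !scalerA mulrC. Qed.
Next Obligation. cbv beta; by move=> *; rewrite scale1r. Qed.
Next Obligation. cbv beta; by move=> *; rewrite scalerA. Qed.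
Next Obligation. cbv beta; by move=> *; rewrite ractDl. Qed.
Next Obligation. cbv beta; by move=> *; rewrite ractDr. Qed.
Next Obligation. cbv beta; by move=> *; rewrite ractZl. Qed.
Next Obligation. cbv beta; by move=> *; rewrite ractZr. Qed.
Next Obligation. cbv beta; by move=> *; rewrite ract1. Qed.
Next Obligation. cbv beta; by move=> *; rewrite ractA. Qed.
Next Obligation. cbv beta; by move=> *; rewrite ractZl. Qed.

(* B ⊗_k X *)
Definition ext (B A' A : algType k) (X : bimod A' A) : bimod B A :=
  algbimod B ⨂ rightmod X.

End ScalarTensor.

Notation "B ⊠ X" := (ext B X) : ring_scope.

Section Extension.
Variables (k : comNzRingType) (B : algType k).

Section Eten.
Variables (A' A : algType k) (X : bimod A' A).

(* The elementary tensor f ⊗ x of B ⊗_k X *)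
Definition eten (f : B) (x : X) : B ⊠ X :=
  @ten k B k^o A (algbimod B) (rightmod X) f x.

Lemma etenDl f f' x : eten (f + f') x = eten f x + eten f' x.
Proof. exact: tenDl. Qed.
Lemma etenDr f x x' : eten f (x + x') = eten f x + eten f x'.
Proof. exact: tenDr. Qed.
Lemma etenZl c f x : eten (c *: f) x = c *: eten f x.
Proof. exact: tenZl. Qed.
Lemma etenZr c f x : eten f (c *: x) = c *: eten f x.
Proof. exact: tenZr. Qed.
Lemma lact_eten (g : B) f x : g ▷ eten f x = eten (g * f) x.
Proof. exact: lact_ten. Qed.
Lemma ract_eten f x (a : A) : eten f x ◁ a = eten f (x ◁ a).
Proof. exact: ract_ten. Qed.

Lemma ext_ind (P : B ⊠ X -> Prop) :
  (forall f x, P (eten f x)) -> (forall u v, P u -> P v -> P (u + v)) ->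
  forall u, P u.
Proof. exact: (@tens_ind k B k^o A (algbimod B) (rightmod X) P). Qed.

Record bilin (V : lmodType k) := Bilin {
  bil_fun :> B -> X -> V;
  bilDl : forall f f' x, bil_fun (f + f') x = bil_fun f x + bil_fun f' x;
  bilDr : forall f x x', bil_fun f (x + x') = bil_fun f x + bil_fun f x';
  bilZl : forall c f x, bil_fun (c *: f) x = c *: bil_fun f x;
  bilZr : forall c f x, bil_fun f (c *: x) = c *: bil_fun f x
}.

Program Definition elift (V : lmodType k) (h : bilin V) :
    {linear B ⊠ X -> V} :=
  tlift (@Balanced _ _ _ _ (algbimod B) (rightmod X) V h _ _ _ _).
Next Obligation. exact: bilDl. Qed.
Next Obligation. exact: bilDr. Qed.
Next Obligation. exact: bilZl. Qed.
Next Obligation. by move=> V h f c x; rewrite [LHS]bilZl [RHS]bilZr. Qed.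

Lemma elift_eten (V : lmodType k) (h : bilin V) f x :
  elift h (eten f x) = h f x.
Proof. exact: tlift_ten. Qed.

End Eten.

Local Notation "f ⊡ x" := (eten f x).

Program Definition etmap (A' A A1' A1 : algType k) (X : bimod A' A)
    (Y : bimod A1' A1) (D : {linear B -> B}) (g : {linear X -> Y}) :
    {linear B ⊠ X -> B ⊠ Y} :=
  elift (@Bilin _ _ X _ (fun f x => D f ⊡ g x) _ _ _ _).
Next Obligation. cbv beta; by move=> *; rewrite linearD etenDl. Qed.
Next Obligation. cbv beta; by move=> *; rewrite linearD etenDr. Qed.
Next Obligation. cbv beta; by move=> *; rewrite linearZ etenZl. Qed.
Next Obligation. cbv beta; by move=> *; rewrite linearZ etenZr. Qed.

Lemma etmap_eten (A' A A1' A1 : algType k) (X : bimod A' A)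
    (Y : bimod A1' A1) (D : {linear B -> B}) (g : {linear X -> Y}) f x :
  etmap D g (f ⊡ x) = D f ⊡ g x.
Proof. exact: elift_eten. Qed.

(* The B-linear extension of g : X -> N *)
Program Definition elinear (A' A A1 : algType k) (X : bimod A' A)
    (N : bimod B A1) (g : {linear X -> N}) : {linear B ⊠ X -> N} :=
  elift (@Bilin _ _ X _ (fun f x => f ▷ g x) _ _ _ _).
Next Obligation. cbv beta; by move=> *; rewrite lactDl. Qed.
Next Obligation. cbv beta; by move=> *; rewrite linearD lactDr. Qed.
Next Obligation. cbv beta; by move=> *; rewrite lactZl. Qed.
Next Obligation. cbv beta; by move=> *; rewrite linearZ lactZr. Qed.

Lemma elinear_eten (A' A A1 : algType k) (X : bimod A' A)
    (N : bimod B A1) (g : {linear X -> N}) f x :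
  elinear g (f ⊡ x) = f ▷ g x.
Proof. exact: elift_eten. Qed.

Section Emul.
Variables (A A1 : algType k) (X : bimod A A1).

Program Definition emul1 (f : B) (a : A) : {linear B ⊠ X -> B ⊠ X} :=
  elift (@Bilin _ _ X _ (fun g x => (f * g) ⊡ (a ▷ x)) _ _ _ _).
Next Obligation. cbv beta; by move=> *; rewrite mulrDr etenDl. Qed.
Next Obligation. cbv beta; by move=> *; rewrite lactDr etenDr. Qed.
Next Obligation. cbv beta; by move=> *; rewrite -scalerAr etenZl. Qed.
Next Obligation. cbv beta; by move=> *; rewrite lactZr etenZr. Qed.

Let emul1E f a g x : emul1 f a (g ⊡ x) = (f * g) ⊡ (a ▷ x).
Proof. exact: elift_eten. Qed.

Program Definition emul_lin (y : B ⊠ X) : {linear B ⊠ regbimod A -> B ⊠ X} :=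
  elift (@Bilin _ _ (regbimod A) _ (fun f a => emul1 f a y) _ _ _ _).
Next Obligation.
cbv beta; elim/ext_ind => [g x|u v IHu IHv] f f' a.
  by rewrite !emul1E mulrDl etenDl.
by rewrite !linearD IHu IHv addrACA.
Qed.
Next Obligation.
cbv beta; elim/ext_ind => [g x|u v IHu IHv] f a a'.
  by rewrite !emul1E lactDl etenDr.
by rewrite !linearD IHu IHv addrACA.
Qed.
Next Obligation.
cbv beta; elim/ext_ind => [g x|u v IHu IHv] c f a.
  by rewrite !emul1E -scalerAl etenZl.
by rewrite !linearD IHu IHv.
Qed.
Next Obligation.
cbv beta; elim/ext_ind => [g x|u v IHu IHv] c f a.
  by rewrite !emul1E lactZl etenZr.
by rewrite !linearD IHu IHv.
Qed.

(* (f ⊗ a) (g ⊗ x) = fg ⊗ ax; for X = A the product of the algebra B ⊗_k A *)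
Definition emul (u : B ⊠ regbimod A) (y : B ⊠ X) : B ⊠ X := emul_lin y u.

Lemma emul_eten f a g x : emul (f ⊡ a) (g ⊡ x) = (f * g) ⊡ (a ▷ x).
Proof. by rewrite /emul elift_eten; exact: emul1E. Qed.

Lemma emulDl u u' y : emul (u + u') y = emul u y + emul u' y.
Proof. exact: linearD. Qed.
Lemma emulZl c u y : emul (c *: u) y = c *: emul u y.
Proof. exact: linearZ. Qed.
Lemma emulDr u y y' : emul u (y + y') = emul u y + emul u y'.
Proof.
elim/ext_ind: u => [f a|u v IHu IHv].
  by rewrite /emul !elift_eten; exact: (linearD (emul1 f a)).
by rewrite !emulDl IHu IHv addrACA.
Qed.
Lemma emulZr c u y : emul u (c *: y) = c *: emul u y.
Proof.
elim/ext_ind: u => [f a|u v IHu IHv].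
  by rewrite /emul !elift_eten; exact: (linearZ_LR (emul1 f a)).
by rewrite !emulDl IHu IHv scalerDr.
Qed.

End Emul.
End Extension.

Notation "f ⊡ x" := (eten f x) : ring_scope.
Notation "u ∙ y" := (emul u y) : ring_scope.

Section EmulTheory.
Variables (k : comNzRingType) (B A A1 : algType k) (X : bimod A A1).

Lemma emul_ract (u : B ⊠ regbimod A) (y : B ⊠ X) (a : A1) :
  u ∙ (y ◁ a) = (u ∙ y) ◁ a.
Proof.
elim/ext_ind: u => [f a0|u v IHu IHv]; last by rewrite !emulDl IHu IHv ractDl.
elim/ext_ind: y => [g x|y z IHy IHz].
  by rewrite !(ract_eten, emul_eten) lractA.
by rewrite ractDl !emulDr IHy IHz ractDl.
Qed.

Lemma emul_bal (u : B ⊠ regbimod A) (a : A) (f : B) (x : X) :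
  (u ◁ a) ∙ (f ⊡ x) = u ∙ (f ⊡ (a ▷ x)).
Proof.
elim/ext_ind: u => [g a0|u v IHu IHv].
  by rewrite ract_eten !emul_eten /= -lactA.
by rewrite ractDl !emulDl IHu IHv.
Qed.

Lemma emul_lactl (g : B) (u : B ⊠ regbimod A) (y : B ⊠ X) :
  (g ▷ u) ∙ y = g ▷ (u ∙ y).
Proof.
elim/ext_ind: u => [f a|u v IHu IHv]; last first.
  by rewrite lactDr !emulDl IHu IHv lactDr.
elim/ext_ind: y => [h x|y z IHy IHz]; last by rewrite !emulDr IHy IHz lactDr.
by rewrite !(lact_eten, emul_eten) mulrA.
Qed.

Lemma emulA (u v : B ⊠ regbimod A) (y : B ⊠ X) : (u ∙ v) ∙ y = u ∙ (v ∙ y).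
Proof.
elim/ext_ind: u => [f a|u u' IHu IHu']; last by rewrite !emulDl IHu IHu'.
elim/ext_ind: v => [g a'|v v' IHv IHv']; last first.
  by rewrite emulDr !emulDl IHv IHv' emulDr.
elim/ext_ind: y => [h x|y z IHy IHz]; last by rewrite !emulDr IHy IHz.
by rewrite !emul_eten mulrA [_ ▷ a']/( _ * _) lactA.
Qed.

Lemma emul1l (y : B ⊠ X) : eten (X := regbimod A) 1 (1 : A) ∙ y = y.
Proof.
elim/ext_ind: y => [h x|y z IHy IHz]; last by rewrite emulDr IHy IHz.
by rewrite [LHS]emul_eten mul1r lact1.
Qed.

Lemma elinear_lact (N : bimod B A1) (h : {linear X -> N}) (g : B) y :
  elinear h (g ▷ y) = g ▷ elinear h y.
Proof.
elim/ext_ind: y => [f x|y z IHy IHz].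
  by rewrite lact_eten !elinear_eten lactA.
by rewrite lactDr !linearD IHy IHz lactDr.
Qed.

Lemma elinear_ract (N : bimod B A1) (h : rmod_map X N) y (a : A1) :
  elinear h (y ◁ a) = elinear h y ◁ a.
Proof.
elim/ext_ind: y => [f x|y z IHy IHz].
  by rewrite ract_eten !elinear_eten rmod_funr lractA.
by rewrite ractDl !linearD IHy IHz ractDl.
Qed.

End EmulTheory.

Lemma emul_lactr (k : comNzRingType) (B : comAlgType k) (A A1 : algType k)
    (X : bimod A A1) (g : B) (u : B ⊠ regbimod A) (y : B ⊠ X) :
  u ∙ (g ▷ y) = g ▷ (u ∙ y).
Proof.
elim/ext_ind: u => [f a|u v IHu IHv]; last by rewrite !emulDl IHu IHv lactDr.
elim/ext_ind: y => [h x|y z IHy IHz].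
  by rewrite !(lact_eten, emul_eten) mulrCA.
by rewrite lactDr !emulDr IHy IHz lactDr.
Qed.

Definition right_generates (k : comNzRingType) (B A : algType k)
    (X : bimod B A) (S : X -> Prop) : Prop :=
  forall w : X, exists2 s : seq (X * A),
    (forall p, p \in s -> S p.1) & w = \sum_(p <- s) p.1 ◁ p.2.

Section VectorField.
Variables (k : comNzRingType) (B A : algType k) (Om : fodc A).
Variable K : rmod_map Om (B ⊠ regbimod A).

(* K (K ⊗ id), with K extended B-linearly on the outside *)
Program Definition KK : {linear Om ⨂ Om -> B ⊠ regbimod A} :=
  tlift (@Balanced _ _ _ _ Om Om _
    (fun xi eta => elinear K (K xi ∙ (1 ⊡ eta))) _ _ _ _).
Next Obligation. cbv beta; by move=> *; rewrite linearD emulDl linearD. Qed.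
Next Obligation. cbv beta; by move=> *; rewrite etenDr emulDr linearD. Qed.
Next Obligation. cbv beta; by move=> *; rewrite linearZ emulZl linearZ. Qed.
Next Obligation. cbv beta; by move=> *; rewrite rmod_funr emul_bal. Qed.

Lemma KK_ten xi eta : KK (xi ⊗ eta) = elinear K (K xi ∙ (1 ⊡ eta)).
Proof. exact: tlift_ten. Qed.

End VectorField.

Local Open Scope complex_scope.
Local Open Scope classical_set_scope.

Section SmoothReal.
Variable R : realType.
Implicit Types u v : R -> R.

Definition smooth_real u := forall (n : nat) (x : R), derivable (u^`(n)) x 1.

Fixpoint diffable n u : Prop :=
  (forall x, derivable u x 1) /\ (if n is m.+1 then diffable m u^`() else True).

Lemma smooth_realP u : smooth_real u <-> forall n, diffable n u.
Proof.
split=> [su n|du n].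
  elim: n u su => [|n IHn] u su; split => //; try exact: (su 0%N).
  by apply: IHn => m x; have := su m.+1 x; rewrite /derive1n iterSr.
elim: n u du => [|n IHn] u du x; first exact: (du 0%N).1.
rewrite /derive1n iterSr; apply: IHn => m; exact: (du m.+1).2.
Qed.

Lemma smooth_derivable u : smooth_real u -> forall x, derivable u x 1.
Proof. move=> su x; exact: su 0%N x. Qed.

Lemma smooth_real_derive u : smooth_real u -> smooth_real u^`().
Proof. by move=> su n x; have := su n.+1 x; rewrite /derive1n iterSr. Qed.

Lemma diffableW n u : diffable n.+1 u -> diffable n u.
Proof.
elim: n u => [|n IHn] u [du dSu]; first by split.
by split=> //; exact: IHn dSu.
Qed.

Lemma derive1_cstE (c : R) : (fun=> c : R)^`() = (fun=> 0).
Proof. by apply/funext => x; rewrite derive1_cst. Qed.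

Lemma derive1D u v : (forall x, derivable u x 1) ->
  (forall x, derivable v x 1) ->
  (fun x => u x + v x)^`() = (fun x => derive1 u x + derive1 v x).
Proof.
move=> du dv; apply/funext => x; rewrite !derive1E.
exact: deriveD (du x) (dv x).
Qed.

Lemma derive1M u v : (forall x, derivable u x 1) ->
  (forall x, derivable v x 1) ->
  (fun x => u x * v x)^`() = (fun x => derive1 u x * v x + u x * derive1 v x).
Proof.
move=> du dv; apply/funext => x; rewrite !derive1E.
rewrite [LHS](deriveM (du x) (dv x)).
by rewrite [LHS]addrC; congr (_ + _); exact: mulrC.
Qed.

Lemma diffable_cst n (c : R) : diffable n (fun=> c).
Proof.
elim: n c => [|n IHn] c; split=> //; try by move=> x; exact: derivable_cst.
by rewrite derive1_cstE.
Qed.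

Lemma diffableD n u v : diffable n u -> diffable n v ->
  diffable n (fun x => u x + v x).
Proof.
elim: n u v => [|n IHn] u v hu hv.
  by split=> [x|]; [exact: (derivableD (hu.1 x) (hv.1 x))|exact: I].
split=> [x|]; first exact: (derivableD (hu.1 x) (hv.1 x)).
by rewrite (derive1D hu.1 hv.1); exact: IHn hu.2 hv.2.
Qed.

Lemma diffableM n u v : diffable n u -> diffable n v ->
  diffable n (fun x => u x * v x).
Proof.
elim: n u v => [|n IHn] u v hu hv.
  by split=> [x|]; [exact: (derivableM (hu.1 x) (hv.1 x))|exact: I].
split=> [x|]; first exact: (derivableM (hu.1 x) (hv.1 x)).
rewrite (derive1M hu.1 hv.1).
apply: diffableD (IHn _ _ hu.2 (diffableW hv)) (IHn _ _ (diffableW hu) hv.2).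
Qed.

Lemma smooth_cst (c : R) : smooth_real (fun=> c).
Proof. by apply/smooth_realP => n; exact: diffable_cst. Qed.
Arguments smooth_cst : clear implicits.

Lemma smoothD u v : smooth_real u -> smooth_real v ->
  smooth_real (fun x => u x + v x).
Proof.
by move=> /smooth_realP su /smooth_realP sv; apply/smooth_realP => n;
  exact: diffableD.
Qed.
Lemma smoothM u v : smooth_real u -> smooth_real v ->
  smooth_real (fun x => u x * v x).
Proof.
by move=> /smooth_realP su /smooth_realP sv; apply/smooth_realP => n;
  exact: diffableM.
Qed.
Lemma smoothN u : smooth_real u -> smooth_real (fun x => - u x).
Proof.
move=> su; rewrite (_ : (fun x => _) = (fun x => -1 * u x)).
  exact: (smoothM (smooth_cst (-1)) su).
by apply/funext => x; rewrite mulN1r.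
Qed.
Lemma smooth_id : smooth_real (fun x : R => x).
Proof.
apply/smooth_realP => -[|n]; split => //; try by move=> x; exact: derivable_id.
have -> : (fun x : R => x)^`() = (fun=> 1).
  by apply/funext => x; rewrite derive1E derive_id.
exact: diffable_cst.
Qed.

End SmoothReal.
Arguments smooth_cst : clear implicits.

Section Cinf.
Variable R : realType.
Implicit Types f g : R -> R[i].

Definition smooth f :=
  smooth_real (fun t => complex.Re (f t)) /\ smooth_real (fun t => complex.Im (f t)).

Definition cderive f (t : R) : R[i] :=
  (fun s => complex.Re (f s))^`() t +i* (fun s => complex.Im (f s))^`() t.

Lemma smoothC_cst (c : R[i]) : smooth (fun=> c).
Proof. by split; exact: smooth_cst. Qed.

Lemma smoothC_D f g : smooth f -> smooth g -> smooth (fun t => f t + g t).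
Proof.
move=> [rf jf] [rg jg]; split.
  rewrite (_ : (fun t => _) = (fun t => complex.Re (f t) + complex.Re (g t))).
    exact: smoothD.
  by apply/funext => t; case: (f t) (g t) => ? ? [].
rewrite (_ : (fun t => _) = (fun t => complex.Im (f t) + complex.Im (g t))).
  exact: smoothD.
by apply/funext => t; case: (f t) (g t) => ? ? [].
Qed.

Lemma smoothC_M f g : smooth f -> smooth g -> smooth (fun t => f t * g t).
Proof.
move=> [rf jf] [rg jg]; split.
  rewrite (_ : (fun t => _) =
      (fun t => complex.Re (f t) * complex.Re (g t) + - (complex.Im (f t) * complex.Im (g t)))).
    by apply: smoothD; last apply: smoothN; exact: smoothM.
  by apply/funext => t; case: (f t) (g t) => ? ? [].
rewrite (_ : (fun t => _) =
    (fun t => complex.Re (f t) * complex.Im (g t) + complex.Im (f t) * complex.Re (g t))).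
  by apply: smoothD; exact: smoothM.
by apply/funext => t; case: (f t) (g t) => ? ? [].
Qed.

Lemma smoothC_derive f : smooth f -> smooth (cderive f).
Proof.
move=> [rf jf].
exact: conj (smooth_real_derive rf) (smooth_real_derive jf).
Qed.

Lemma cderive_cst (c : R[i]) : cderive (fun=> c) = (fun=> 0).
Proof. by apply/funext => t; rewrite /cderive !derive1_cstE. Qed.

Lemma cderiveD f g : smooth f -> smooth g ->
  cderive (fun t => f t + g t) = (fun t => cderive f t + cderive g t).
Proof.
move=> [rf jf] [rg jg]; apply/funext => t; rewrite /cderive.
rewrite (_ : (fun s => complex.Re (f s + g s)) = (fun s => complex.Re (f s) + complex.Re (g s))).
  rewrite (_ : (fun s => complex.Im (f s + g s)) = (fun s => complex.Im (f s) + complex.Im (g s))).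
    rewrite (derive1D (smooth_derivable rf) (smooth_derivable rg)).
    by rewrite (derive1D (smooth_derivable jf) (smooth_derivable jg)).
  by apply/funext => s; case: (f s) (g s) => ? ? [].
by apply/funext => s; case: (f s) (g s) => ? ? [].
Qed.

Lemma cderiveM f g : smooth f -> smooth g ->
  cderive (fun t => f t * g t) =
  (fun t => cderive f t * g t + f t * cderive g t).
Proof.
move=> [rf jf] [rg jg]; apply/funext => t; rewrite /cderive.
have -> : (fun s => complex.Re (f s * g s)) =
    (fun s => complex.Re (f s) * complex.Re (g s) + (- 1 * (complex.Im (f s) * complex.Im (g s)))).
  by apply/funext => s; rewrite mulN1r; case: (f s) (g s) => ? ? [].
have -> : (fun s => complex.Im (f s * g s)) =
    (fun s => complex.Re (f s) * complex.Im (g s) + complex.Im (f s) * complex.Re (g s)).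
  by apply/funext => s; case: (f s) (g s) => ? ? [].
have dM (u v : R -> R) (su : smooth_real u) (sv : smooth_real v) :=
  derive1M (smooth_derivable su) (smooth_derivable sv).
have dD (u v : R -> R) (su : smooth_real u) (sv : smooth_real v) :=
  derive1D (smooth_derivable su) (smooth_derivable sv).
have sII := smoothM jf jg.
rewrite (dD _ _ (smoothM rf rg) (smoothM (smooth_cst R (-1)) sII)).
rewrite (dM _ _ (smooth_cst R (-1)) sII) (dM _ _ rf rg) (dM _ _ jf jg).
rewrite (dD _ _ (smoothM rf jg) (smoothM jf rg)) (dM _ _ rf jg) (dM _ _ jf rg).
rewrite derive1_cstE.
case: (f t) (g t) => a b [c d] /=.
by apply/eqP; rewrite eq_complex /=; apply/andP; split; apply/eqP; ring.
Qed.

Record Cinf := MkCinf { cinf_fun :> R -> R[i]; cinf_smooth : smooth cinf_fun }.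

HB.instance Definition _ := gen_eqMixin Cinf.
HB.instance Definition _ := gen_choiceMixin Cinf.

Lemma cinfP (f g : Cinf) : (forall t, f t = g t) -> f = g.
Proof.
case: f g => [f sf] [g sg] /= fg; have e : f = g by apply/funext.
by subst g; rewrite (Prop_irrelevance sf sg).
Qed.

Definition cinf_cst (c : R[i]) := MkCinf (smoothC_cst c).
Definition cinf_add (f g : Cinf) :=
  MkCinf (smoothC_D (cinf_smooth f) (cinf_smooth g)).
Definition cinf_mul (f g : Cinf) :=
  MkCinf (smoothC_M (cinf_smooth f) (cinf_smooth g)).
Definition cinf_opp (f : Cinf) := cinf_mul (cinf_cst (-1)) f.

Fact cinf_addA : associative cinf_add.
Proof. by move=> f g h; apply/cinfP => t /=; rewrite addrA. Qed.
Fact cinf_addC : commutative cinf_add.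
Proof. by move=> f g; apply/cinfP => t /=; rewrite addrC. Qed.
Fact cinf_add0 : left_id (cinf_cst 0) cinf_add.
Proof. by move=> f; apply/cinfP => t /=; rewrite add0r. Qed.
Fact cinf_addN : left_inverse (cinf_cst 0) cinf_opp cinf_add.
Proof. by move=> f; apply/cinfP => t /=; rewrite mulN1r addNr. Qed.

HB.instance Definition _ :=
  GRing.isZmodule.Build Cinf cinf_addA cinf_addC cinf_add0 cinf_addN.

Fact cinf_mulA : associative cinf_mul.
Proof. by move=> f g h; apply/cinfP => t /=; rewrite mulrA. Qed.
Fact cinf_mulC : commutative cinf_mul.
Proof. by move=> f g; apply/cinfP => t /=; rewrite mulrC. Qed.
Fact cinf_mul1 : left_id (cinf_cst 1) cinf_mul.
Proof. by move=> f; apply/cinfP => t /=; rewrite mul1r. Qed.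
Fact cinf_mulDl : left_distributive cinf_mul +%R.
Proof. by move=> f g h; apply/cinfP => t /=; rewrite mulrDl. Qed.
Fact cinf_1neq0 : cinf_cst 1 != 0.
Proof.
apply/eqP => /(congr1 (fun f : Cinf => f 0)) /eqP; apply/negP.
exact: oner_neq0.
Qed.

HB.instance Definition _ := GRing.Zmodule_isComNzRing.Build Cinf
  cinf_mulA cinf_mulC cinf_mul1 cinf_mulDl cinf_1neq0.

Definition cinf_scale (c : R[i]) (f : Cinf) := cinf_mul (cinf_cst c) f.

Fact cinf_scaleA c c' (f : Cinf) :
  cinf_scale c (cinf_scale c' f) = cinf_scale (c * c') f.
Proof. by apply/cinfP => t /=; rewrite mulrA. Qed.
Fact cinf_scale1 : left_id 1 cinf_scale.
Proof. by move=> f; apply/cinfP => t /=; rewrite mul1r. Qed.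
Fact cinf_scaleDr : right_distributive cinf_scale +%R.
Proof. by move=> c f g; apply/cinfP => t /=; rewrite mulrDr. Qed.
Fact cinf_scaleDl (f : Cinf) : {morph cinf_scale^~ f : a b / a + b}.
Proof. by move=> a b; apply/cinfP => t /=; rewrite mulrDl. Qed.

HB.instance Definition _ := GRing.Zmodule_isLmodule.Build R[i] Cinf
  cinf_scaleA cinf_scale1 cinf_scaleDr cinf_scaleDl.

Fact cinf_scaleAl (c : R[i]) (f g : Cinf) : c *: (f * g) = (c *: f) * g.
Proof. exact: (mulrA (cinf_cst c) f g). Qed.

HB.instance Definition _ :=
  GRing.Lmodule_isLalgebra.Build R[i] Cinf cinf_scaleAl.
HB.instance Definition _ := GRing.Lalgebra_isComAlgebra.Build R[i] Cinf.

Lemma cinf_addE (f g : Cinf) t : (f + g) t = f t + g t. Proof. by []. Qed.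
Lemma cinf_mulE (f g : Cinf) t : (f * g) t = f t * g t. Proof. by []. Qed.
Lemma cinf_scaleE c (f : Cinf) t : (c *: f) t = c * f t. Proof. by []. Qed.

Definition cinf_derive (f : Cinf) := MkCinf (smoothC_derive (cinf_smooth f)).

Lemma cinf_deriveM (f g : Cinf) :
  cinf_derive (f * g) = cinf_derive f * g + f * cinf_derive g.
Proof.
apply/cinfP => t; rewrite cinf_addE !cinf_mulE /= cderiveM //;
  exact: cinf_smooth.
Qed.

Fact cinf_derive_linear : linear cinf_derive.
Proof.
move=> c f g; apply/cinfP => t.
rewrite cinf_addE cinf_scaleE /= cderiveD; first last.
- exact: cinf_smooth.
- by apply: smoothC_M; [exact: smoothC_cst|exact: cinf_smooth].
rewrite cderiveM; first last.
- exact: cinf_smooth.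
- exact: smoothC_cst.
by rewrite cderive_cst mul0r add0r.
Qed.

HB.instance Definition _ := GRing.isLinear.Build R[i] Cinf Cinf _ cinf_derive
  cinf_derive_linear.

Definition tcoord : Cinf := @MkCinf (fun t => t%:C)
  (conj (@smooth_id R) (smooth_cst R 0)).

Lemma cinf_derive_tcoord : cinf_derive tcoord = 1.
Proof.
apply/cinfP => t /=; rewrite /cderive /= derive1_cstE.
by rewrite derive1E derive_id.
Qed.

(* Omega^1(R) is free on dt; the function f stands for the form f dt. *)
Program Definition OmR : fodc Cinf :=
  @Fodc R[i] Cinf (regbimod Cinf) cinf_derive _ _.
Next Obligation. by move=> a b; exact: cinf_deriveM. Qed.
Next Obligation.
move=> w; exists [:: (w, tcoord)]; rewrite big_seq1 /=.
by rewrite cinf_derive_tcoord mulr1.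
Qed.

Definition dt : OmR := d[OmR] tcoord.

Lemma lact_dt (f : Cinf) : f ▷ dt = f.
Proof. by rewrite /dt /= cinf_derive_tcoord mulr1. Qed.


(* f dt |-> dt ⊗ f' dt *)
Definition trivial_nabla (w : OmR) : OmR ⨂ OmR :=
  dt ⊗ (cinf_derive w ▷ dt).

Fact trivial_nabla_linear : linear trivial_nabla.
Proof.
by move=> c v w; rewrite /trivial_nabla linearP lactDl lactZl tenDr tenZr.
Qed.
HB.instance Definition _ := GRing.isLinear.Build R[i] OmR (OmR ⨂ OmR) _
  trivial_nabla trivial_nabla_linear.

Let ten_dt (v w : OmR) : v ⊗ w = dt ⊗ (((v : Cinf) * (w : Cinf)) ▷ dt).
Proof.
rewrite -[v in LHS]lact_dt (_ : (v : Cinf) ▷ dt = dt ◁ (v : Cinf)).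
  by rewrite ten_bal lact_dt.
exact: mulrC.
Qed.

(* sigma is the identity, being the bimodule map that fixes dt ⊗ dt. *)
Program Definition trivial_conn : lbconn OmR OmR OmR :=
  @Lbconn _ _ _ OmR OmR OmR trivial_nabla (bimod_id (OmR ⨂ OmR)) _ _.
Next Obligation.
move=> f w; rewrite lact_ten [d[_] f ⊗ w]ten_dt [(f ▷ dt) ⊗ _]ten_dt -tenDr.
rewrite !lact_dt; congr (dt ⊗ _).
rewrite [LHS]lact_dt; exact: cinf_deriveM.
Qed.
Next Obligation.
move=> w f; rewrite ract_ten [bimod_fun _ _]ten_dt -tenDr.
rewrite !lact_dt; congr (dt ⊗ _).
rewrite [LHS]lact_dt; exact: cinf_deriveM.
Qed.

Lemma trivial_nablaE (f : Cinf) :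
  nabla trivial_conn (f ▷ dt) = dt ⊗ (cinf_derive f ▷ dt).
Proof. by rewrite lact_dt. Qed.

Lemma trivial_sigmaE : sigma trivial_conn (dt ⊗ dt) = dt ⊗ dt.
Proof. by []. Qed.

End Cinf.

Arguments OmR : clear implicits.
Arguments dt {R}.
Arguments trivial_conn : clear implicits.

Section Evolution.
Variables (R : realType) (A : algType R[i]) (Om : fodc A).

(* C^oo(R) ⊗ A *)
Definition CinfA : bimod (Cinf R) A := Cinf R ⊠ regbimod A.

Definition CinfA_one : CinfA := eten (X := regbimod A) 1 (1 : A).

(* f ⊗ a |-> f' ⊗ a *)
Definition ddt : {linear CinfA -> CinfA} :=
  etmap (@cinf_derive R) (idfun : {linear regbimod A -> regbimod A}).

(* f ⊗ a |-> f ⊗ d a *)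
Definition dA : {linear CinfA -> Cinf R ⊠ Om} :=
  etmap (idfun : {linear Cinf R -> Cinf R})
    (fodc_d Om : {linear regbimod A -> Om}).

Variables (b : CinfA) (K : rmod_map Om CinfA).

Local Notation Kx := (elinear (B := Cinf R) K).

Definition evol_nabla (c : CinfA) : OmR R ⨂ CinfA :=
  dt ⊗ (b ∙ c + ddt c + Kx (dA c)).

(* The left C^oo(R)-linear extension of 1 ⊗ xi |-> dt ⊗ K(xi) *)
Program Definition evol_sigma_lin : {linear CinfA ⨂ Om -> OmR R ⨂ CinfA} :=
  tlift (@Balanced _ _ _ _ CinfA Om _ (fun c xi => dt ⊗ Kx (c ∙ (1 ⊡ xi)))
    _ _ _ _).
Next Obligation. cbv beta; by move=> *; rewrite emulDl linearD tenDr. Qed.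
Next Obligation. cbv beta; by move=> *; rewrite etenDr emulDr linearD tenDr. Qed.
Next Obligation. cbv beta; by move=> *; rewrite emulZl linearZ tenZr. Qed.
Next Obligation. cbv beta; by move=> *; rewrite emul_bal. Qed.


Lemma evol_sigma_linE c xi : evol_sigma_lin (c ⊗ xi) = dt ⊗ Kx (c ∙ (1 ⊡ xi)).
Proof. exact: tlift_ten. Qed.

Lemma lact_dt_ten (f : Cinf R) (c : CinfA) :
  f ▷ (dt ⊗ c : OmR R ⨂ CinfA) = dt ⊗ (f ▷ c).
Proof.
rewrite [LHS]lact_ten -ten_bal; congr (_ ⊗ c); exact: mulrC.
Qed.

Program Definition evol_sigma : bimod_map (CinfA ⨂ Om) (OmR R ⨂ CinfA) :=
  @BimodMap _ _ _ _ _ evol_sigma_lin _ _.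
Next Obligation.
move=> f; elim/tens_ind => [c xi|x y IHx IHy].
  by rewrite lact_ten !evol_sigma_linE emul_lactl elinear_lact lact_dt_ten.
by rewrite lactDr !linearD IHx IHy lactDr.
Qed.
Next Obligation.
move=> + a; elim/tens_ind => [c xi|x y IHx IHy].
  rewrite ract_ten !evol_sigma_linE ract_ten; congr (dt ⊗ _).
  by rewrite -ract_eten emul_ract elinear_ract.
by rewrite ractDl !linearD IHx IHy ractDl.
Qed.

Lemma ddt_lact (f : Cinf R) c : ddt (f ▷ c) = cinf_derive f ▷ c + f ▷ ddt c.
Proof.
elim/ext_ind: c => [g a|u v IHu IHv].
  by rewrite lact_eten /ddt !etmap_eten !lact_eten -etenDl; congr (_ ⊡ _);
    exact: cinf_deriveM.
rewrite lactDr (linearD ddt) IHu IHv !lactDr (linearD ddt) lactDr.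
exact: addrACA.
Qed.

Lemma ddt_ract c (a : A) : ddt (c ◁ a) = ddt c ◁ a.
Proof.
elim/ext_ind: c => [g a'|u v IHu IHv].
  by rewrite ract_eten /ddt !etmap_eten ract_eten.
by rewrite ractDl !linearD IHu IHv !ractDl.
Qed.

Lemma dA_lact (f : Cinf R) c : dA (f ▷ c) = f ▷ dA c.
Proof.
elim/ext_ind: c => [g a|u v IHu IHv].
  by rewrite lact_eten /dA !etmap_eten lact_eten.
by rewrite lactDr !linearD IHu IHv !lactDr.
Qed.

Lemma dA_ract c (a : A) : dA (c ◁ a) = dA c ◁ a + c ∙ (1 ⊡ d[Om] a).
Proof.
elim/ext_ind: c => [g a'|u v IHu IHv].
  rewrite ract_eten /dA !etmap_eten ract_eten emul_eten mulr1 -etenDr.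
  by congr (_ ⊡ _); exact: fodc_leibniz.
by rewrite ractDl !linearD IHu IHv !ractDl emulDl addrACA.
Qed.

Fact evol_nabla_linear : linear evol_nabla.
Proof.
move=> r c e; rewrite /evol_nabla -tenZr -tenDr; congr (dt ⊗ _).
rewrite emulDr emulZr (linearP ddt) (linearP dA) (linearP (elinear K)).
rewrite !scalerDr.
have H (V : zmodType) (x y z w u v : V) :
  x + y + (z + w) + (u + v) = x + z + u + (y + w + v).
  by rewrite (addrACA x) [LHS]addrACA.
exact: H.
Qed.
HB.instance Definition _ := GRing.isLinear.Build R[i] CinfA (OmR R ⨂ CinfA) _
  evol_nabla evol_nabla_linear.

Program Definition evol_conn : lbconn (OmR R) Om CinfA :=
  @Lbconn _ _ _ (OmR R) Om CinfA evol_nabla evol_sigma _ _.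
Next Obligation.
move=> f c; rewrite lact_dt_ten.
have -> : d[OmR R] f ⊗ c = dt ⊗ (cinf_derive f ▷ c).
  rewrite -ten_bal; congr (_ ⊗ c).
  by rewrite -[LHS]lact_dt; exact: mulrC.
rewrite -tenDr; congr (dt ⊗ _).
rewrite emul_lactr ddt_lact dA_lact elinear_lact !lactDr.
by rewrite [X in X + _ = _]addrCA -addrA.
Qed.
Next Obligation.
move=> c a; rewrite [bimod_fun _ _]evol_sigma_linE ract_ten -tenDr.
congr (dt ⊗ _).
by rewrite emul_ract ddt_ract dA_ract linearD elinear_ract !ractDl !addrA.
Qed.

Lemma evol_nablaE (c : CinfA) :
  nabla evol_conn c = dt ⊗ (b ∙ c + ddt c + Kx (dA c)).
Proof. by []. Qed.

Lemma evol_sigmaE (xi : Om) :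
  sigma evol_conn (CinfA_one ⊗ xi) = dt ⊗ K xi.
Proof.
rewrite [LHS]evol_sigma_linE [CinfA_one ∙ _]emul1l elinear_eten.
by congr (dt ⊗ _); exact: lact1.
Qed.

Definition velocity_eq (cO : lbconn Om Om Om)
    (sinv : Om ⨂ Om -> Om ⨂ Om) (xi : Om) : Prop :=
  ddt (K xi) =
  Kx (b ∙ (1 ⊡ xi)) - b ∙ K xi + KK K (sinv (nabla cO xi)) - Kx (dA (K xi)).

End Evolution.

Arguments CinfA : clear implicits.
Arguments CinfA_one : clear implicits.
Arguments ddt {R A}.
Arguments dA {R A} Om.

(* Main.v *)
(** By the left Leibniz rule for tensor product connections, D(σ_M) is left
    C^∞(R)-linear, and M ⊗ Ω¹_A is generated over C^∞(R) by the elements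
    1 ⊗ ξ. There D(σ_M) equals dt ⊗ dt ⊗ G(ξ), where
      G(ξ) = ∂K(ξ)/∂t + b K(ξ) + K(dK(ξ)) - K(bξ) - K(K ⊗ id)∇ξ,
    so D(σ_M) = 0 iff G = 0. Moreover
      G(ξa) = G(ξ)a + K(K ⊗ id)(ξ ⊗ da) - K(K ⊗ id)σ(ξ ⊗ da),
    and the ξ ⊗ da span, so G = 0 forces K(K ⊗ id)σ = K(K ⊗ id), after which
    ∇ and σ⁻¹∇ may be interchanged under K(K ⊗ id). With σ⁻¹∇ in place of ∇
    the two correction terms cancel and G becomes a right module map, which
    gives the statements on right multiples and right generators. *)
Require Import Defs.
From mathcomp Require Import all_boot all_order all_algebra.
From mathcomp Require Import complex.
From mathcomp Require Import all_classical all_reals all_analysis.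

Set Implicit Arguments.
Unset Strict Implicit.
Unset Printing Implicit Defensive.

Import GRing.Theory.
Local Open Scope ring_scope.

(** * Zero, negatives and inverse maps in bimodules and their tensor products *)

Section BimoduleTheory.
Variables (k : comNzRingType) (B A E : algType k).
Variables (M : bimod B A) (N : bimod A E).

Lemma lact0 (f : B) : f ▷ (0 : M) = 0.
Proof. by rewrite -(scale0r (0 : M)) lactZr !scale0r. Qed.

Lemma lactN (f : B) (m : M) : f ▷ (- m) = - (f ▷ m).
Proof. by rewrite -scaleN1r lactZr scaleN1r. Qed.

Lemma ract0 (a : A) : (0 : M) ◁ a = 0.
Proof. by rewrite -(scale0r (0 : M)) ractZl !scale0r. Qed.

Lemma ractN (m : M) (a : A) : (- m) ◁ a = - (m ◁ a).
Proof. by rewrite -scaleN1r ractZl scaleN1r. Qed.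

Lemma ten0r (m : M) : m ⊗ (0 : N) = 0.
Proof. by rewrite -(scale0r (0 : N)) tenZr scale0r. Qed.

Lemma tenNr (m : M) (n : N) : m ⊗ (- n) = - (m ⊗ n).
Proof. by rewrite -scaleN1r tenZr scaleN1r. Qed.

Lemma ten0l (n : N) : (0 : M) ⊗ n = 0.
Proof. by rewrite -(scale0r (0 : M)) tenZl scale0r. Qed.

(** For the inverse of σ, which is given as a bare function: both identities may be checked after
    applying the injective map [s]. *)
Lemma can_bimod_map_ract (s : bimod_map M M) (s' : M -> M) :
  cancel s s' -> cancel s' s ->
  (forall m m', s' (m + m') = s' m + s' m') /\
  (forall m (a : A), s' (m ◁ a) = s' m ◁ a).
Proof.
move=> sK s'K; split=> [m m'|m a]; apply: (can_inj sK).
  by rewrite linearD !s'K.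
by rewrite bimod_funr !s'K.
Qed.

End BimoduleTheory.

Lemma tassoc_lact (k : comNzRingType) (F B A E : algType k) (L : bimod F B)
    (M : bimod B A) (N : bimod A E) (f : F) (x : (L ⨂ M) ⨂ N) :
  tassoc L M N (f ▷ x) = f ▷ tassoc L M N x.
Proof.
elim/tens_ind: x => [y n|x y IHx IHy]; last first.
  by rewrite lactDr !linearD IHx IHy lactDr.
elim/tens_ind: y => [l m|x y IHx IHy].
  by rewrite !lact_ten !tassocE lact_ten.
by rewrite tenDl lactDr !linearD IHx IHy lactDr.
Qed.

Lemma cinf_derive1 (R : realType) : cinf_derive (1 : Cinf R) = 0.
Proof. by apply/cinfP => t; rewrite /= cderive_cst. Qed.

Lemma fodc_d1 (k : comNzRingType) (A : algType k) (Om : fodc A) :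
  d[Om] (1 : A) = 0.
Proof.
have := fodc_leibniz Om 1 1; rewrite mulr1 ract1 lact1 => h.
by apply: (addrI (d[Om] 1)); rewrite -h addr0.
Qed.

(** * Left Leibniz rule for tensor product connections *)

Section TensorConnectionLeft.
Variables (k : comNzRingType) (F B A : algType k).
Variables (OmF : fodc F) (OmB : fodc B) (OmA : fodc A).
Variables (Q : bimod F B) (M : bimod B A).
Variables (cQ : lbconn OmF OmB Q) (cM : lbconn OmB OmA M).

Lemma sigma_tens_id_lact (f : F) q (y : OmB ⨂ M) :
  sigma_tens_id (M := M) cQ ((f ▷ q) ⊗ y) =
  f ▷ sigma_tens_id (M := M) cQ (q ⊗ y).
Proof.
elim/tens_ind: y => [w m|x y IHx IHy].
  by rewrite !sigma_tens_idE -lact_ten bimod_funl -lact_ten tassoc_lact.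
have sD := linearD (sigma_tens_id (M := M) cQ).
by rewrite !tenDr [LHS]sD [in RHS]sD [LHS](congr2 +%R IHx IHy) -lactDr.
Qed.

(** Only the summand with [nabla cQ] produces [d f]; the other one is left linear because [sigma cQ]
    is. *)
Lemma nabla_tens_lact (f : F) x :
  nabla_tens cQ cM (f ▷ x) = d[OmF] f ⊗ x + f ▷ nabla_tens cQ cM x.
Proof.
elim/tens_ind: x => [q m|x y IHx IHy].
  rewrite lact_ten !nabla_tensE nabla_lact tenDl linearD tassocE.
  by rewrite -lact_ten tassoc_lact sigma_tens_id_lact lactDr addrA.
by rewrite lactDr !linearD IHx IHy tenDr lactDr addrACA.
Qed.

End TensorConnectionLeft.

(** * Left linearity of D(σ) *)

Section DsigmaTheory.
Variables (k : comNzRingType) (B A : algType k) (OmB : fodc B) (OmA : fodc A).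
Variables (M : bimod B A).
Variables (cB : lbconn OmB OmB OmB) (cA : lbconn OmA OmA OmA).
Variables (cM : lbconn OmB OmA M).

Lemma DsigmaD x y :
  Dsigma cB cA cM (x + y) = Dsigma cB cA cM x + Dsigma cB cA cM y.
Proof. by rewrite /Dsigma !linearD addrACA. Qed.

(** Both terms of D(σ) contribute [d f ⊗ sigma cM x], and the two copies cancel. *)
Lemma Dsigma_lact (f : B) x :
  Dsigma cB cA cM (f ▷ x) = f ▷ Dsigma cB cA cM x.
Proof.
rewrite /Dsigma bimod_funl !nabla_tens_lact.
rewrite (linearD (tmap (bimod_id OmB) (sigma cM))) tmap_ten bimod_funl.
by rewrite opprD addrACA subrr add0r lactDr lactN.
Qed.

End DsigmaTheory.

#[local] Obligation Tactic := idtac.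

(** * Injectivity of n ↦ dt ⊗ n *)

Section DtCoefficient.
Variables (R : realType) (A : algType R[i]) (N : bimod (Cinf R) A).

(** A form [w] on the line is stored as its coefficient of dt, so it can act on [n] directly as a
    function. *)
Program Definition dt_coef : {linear OmR R ⨂ N -> N} :=
  tlift (@Balanced _ _ _ _ (OmR R) N N (fun w n => (w : Cinf R) ▷ n)
    _ _ _ _).
Next Obligation. by move=> v w n; exact: lactDl. Qed.
Next Obligation. by move=> w n n'; exact: lactDr. Qed.
Next Obligation. by move=> c w n; exact: lactZl. Qed.
Next Obligation. by move=> w f n; exact: lactA. Qed.

Lemma dt_coefK : cancel (ten dt : N -> OmR R ⨂ N) dt_coef.
Proof.
move=> n; rewrite [LHS]tlift_ten -[RHS]lact1.
by congr (_ ▷ _); exact: cinf_derive_tcoord.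
Qed.

End DtCoefficient.

Lemma nabla_dt (R : realType) : nabla (trivial_conn R) dt = 0.
Proof.
rewrite -[dt in LHS](lact1) trivial_nablaE cinf_derive1.
by rewrite -[0 : Cinf R](scale0r (0 : Cinf R)) lactZl scale0r ten0r.
Qed.

(** * The evolution connection and the obstruction to D(σ) = 0 *)

Section Evolution.
Variables (R : realType) (A : algType R[i]) (Om : fodc A).
Variables (b : CinfA R A) (K : rmod_map Om (CinfA R A)).

Local Notation Kx := (elinear (B := Cinf R) K).
Local Notation one := (CinfA_one R A).

(** The dt coefficient of the connection on M. *)
Definition evolve (c : CinfA R A) : CinfA R A := b ∙ c + ddt c + Kx (dA Om c).

Lemma evolve_one : evolve one = b.
Proof.
rewrite /evolve.
have -> : ddt one = 0.
  by rewrite [LHS]etmap_eten [X in eten X _](cinf_derive1 R); exact: ten0l.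
have -> : dA Om one = 0.
  by rewrite [LHS]etmap_eten [X in eten _ X](fodc_d1 Om); exact: ten0r.
rewrite linear0 !addr0.
elim/ext_ind: b => [f a|u v IHu IHv]; last by rewrite emulDl IHu IHv.
by rewrite emul_eten mulr1 /= mulr1.
Qed.

Lemma evolveD (c c' : CinfA R A) : evolve (c + c') = evolve c + evolve c'.
Proof.
rewrite /evolve emulDr (linearD ddt) (linearD (dA Om)) (linearD Kx).
by rewrite [X in X + _ = _]addrACA [LHS]addrACA.
Qed.

Lemma evolve_ract (c : CinfA R A) (a : A) :
  evolve (c ◁ a) = evolve c ◁ a + Kx (c ∙ (1 ⊡ d[Om] a)).
Proof.
by rewrite /evolve emul_ract ddt_ract dA_ract linearD elinear_ract !ractDl !addrA.
Qed.

Variables (cM : lbconn (OmR R) Om (CinfA R A)).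
Hypothesis nabla_cM : forall c : CinfA R A, nabla cM c = dt ⊗ evolve c.
Hypothesis sigma_cM : forall xi : Om, sigma cM (one ⊗ xi) = dt ⊗ K xi.
Variable cO : lbconn Om Om Om.

Lemma ten_eten (f : Cinf R) (a : A) (xi : Om) :
  ((f ⊡ (a : regbimod A) : CinfA R A) ⊗ xi) = f ▷ (one ⊗ (a ▷ xi)).
Proof.
by rewrite lact_ten -ten_bal [f ▷ _]lact_eten mulr1 ract_eten /= mul1r.
Qed.

(** The values on 1 ⊗ ξ determine σ: by [ten_eten], f ⊗ a ⊗ ξ is f times 1 ⊗ aξ, and σ is left
    linear. *)
Lemma sigma_ten (c : CinfA R A) (xi : Om) :
  sigma cM (c ⊗ xi) = dt ⊗ Kx (c ∙ (1 ⊡ xi)).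
Proof.
elim/ext_ind: c => [f a|u v IHu IHv]; last first.
  by rewrite tenDl linearD IHu IHv emulDl linearD tenDr.
rewrite ten_eten bimod_funl sigma_cM lact_dt_ten emul_eten mulr1.
by rewrite elinear_eten.
Qed.

(** This is G(ξ); [evolve (K xi)] collects its three positive terms. *)
Definition defect (xi : Om) : CinfA R A :=
  evolve (K xi) - (Kx (b ∙ (1 ⊡ xi)) + KK K (nabla cO xi)).

Lemma nabla_tens_dt (m : CinfA R A) :
  nabla_tens (trivial_conn R) cM (dt ⊗ m) = dt ⊗ (dt ⊗ evolve m).
Proof.
rewrite [LHS]nabla_tensE nabla_dt ten0l linear0 add0r nabla_cM.
by rewrite [LHS]sigma_tens_idE trivial_sigmaE [LHS]tassocE.
Qed.

Lemma nabla_tens_one (xi : Om) :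
  nabla_tens cM cO (one ⊗ xi) =
  dt ⊗ (b ⊗ xi) + sigma_tens_id (M := Om) cM (one ⊗ nabla cO xi).
Proof. by rewrite [LHS]nabla_tensE nabla_cM evolve_one tassocE. Qed.

(** On η ⊗ ζ the first σ turns 1 ⊗ η into dt ⊗ K(η), and the second turns K(η) ⊗ ζ into dt ⊗
    K(K(η)ζ). *)
Lemma sigma_sigma_one (y : Om ⨂ Om) :
  tmap (bimod_id (OmR R)) (sigma cM)
    (sigma_tens_id (M := Om) cM (one ⊗ y)) = dt ⊗ (dt ⊗ KK K y).
Proof.
have sD := linearD (sigma_tens_id (M := Om) cM).
have tD := linearD (tmap (bimod_id (OmR R)) (sigma cM)).
elim/tens_ind: y => [eta zeta|x y IHx IHy].
  rewrite [X in bimod_fun _ X]sigma_tens_idE sigma_cM.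
  rewrite [X in bimod_fun _ X]tassocE [LHS]tmap_ten sigma_ten.
  by rewrite KK_ten.
rewrite tenDr [X in bimod_fun _ X]sD [LHS]tD [LHS](congr2 +%R IHx IHy).
by rewrite -!tenDr -linearD.
Qed.

Lemma Dsigma_one (xi : Om) :
  Dsigma (trivial_conn R) cO cM (one ⊗ xi) = dt ⊗ (dt ⊗ defect xi).
Proof.
have tD := linearD (tmap (bimod_id (OmR R)) (sigma cM)).
rewrite /Dsigma sigma_cM nabla_tens_dt nabla_tens_one.
rewrite [X in _ - X]tD sigma_sigma_one [X in _ - (X + _)]tmap_ten sigma_ten.
by rewrite -!tenDr -!tenNr -!tenDr.
Qed.

Lemma Dsigma_eq0 :
  (forall x, Dsigma (trivial_conn R) cO cM x = 0) <->
  (forall xi, defect xi = 0).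
Proof.
split=> [D0 xi|G0].
  (* Strip the two factors dt in turn. *)
  apply/(can_inj (@dt_coefK _ _ _))/(can_inj (@dt_coefK _ _ _)).
  by rewrite -Dsigma_one D0 !ten0r.
elim/tens_ind => [c xi|x y Dx Dy]; last by rewrite DsigmaD Dx Dy addr0.
elim/ext_ind: c => [f a|u v IHu IHv]; last first.
  by rewrite tenDl DsigmaD IHu IHv addr0.
by rewrite ten_eten Dsigma_lact Dsigma_one G0 !ten0r lact0.
Qed.

Lemma KK_ract y (a : A) : KK K (y ◁ a) = KK K y ◁ a.
Proof.
elim/tens_ind: y => [xi eta|x y IHx IHy].
  by rewrite ract_ten !KK_ten -ract_eten emul_ract elinear_ract.
by rewrite ractDl !linearD IHx IHy ractDl.
Qed.

(** The term in ξ ⊗ da comes from K(d(K(ξ)a)), the one in σ(ξ ⊗ da) from the right Leibniz rule of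
    [nabla cO]. *)
Lemma defect_ract (xi : Om) (a : A) :
  defect (xi ◁ a) = defect xi ◁ a
    + (KK K (xi ⊗ d[Om] a) - KK K (sigma cO (xi ⊗ d[Om] a))).
Proof.
rewrite /defect rmod_funr evolve_ract -ract_eten emul_ract elinear_ract.
rewrite nabla_ract (linearD (KK K)) KK_ract -KK_ten.
rewrite ractDl ractN (ractDl (Kx _)).
by rewrite [X in _ - X = _]addrA opprD addrACA.
Qed.

Lemma KK_sigma : (forall xi, defect xi = 0) ->
  forall y, KK K (sigma cO y) = KK K y.
Proof.
move=> G0; elim/tens_ind => [xi eta|x y IHx IHy]; last by rewrite !linearD IHx IHy.
have [s ->] := fodc_span eta.
elim: s => [|p s IHs]; first by rewrite big_nil ten0r !linear0.
(* Balancing turns ξ ⊗ a db into ξa ⊗ db, to which [defect_ract] applies at ξa and b. *)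
rewrite big_cons tenDr !linearD IHs -ten_bal; congr (_ + _).
have := defect_ract (xi ◁ p.1) p.2; rewrite !G0 ract0 add0r.
by move=> /esym/eqP; rewrite subr_eq0 => /eqP.
Qed.

(** * The velocity equation as the vanishing of a right module map *)

Variable sinv : Om ⨂ Om -> Om ⨂ Om.
Hypotheses (sigmaK : cancel (sigma cO) sinv) (sinvK : cancel sinv (sigma cO)).

Definition velocity_defect (xi : Om) : CinfA R A :=
  evolve (K xi) - (Kx (b ∙ (1 ⊡ xi)) + KK K (sinv (nabla cO xi))).

Lemma velocity_eqP xi :
  velocity_eq b K cO sinv xi <-> velocity_defect xi = 0.
Proof.
rewrite /velocity_eq /velocity_defect /evolve.
move: (ddt _) (Kx (b ∙ (1 ⊡ xi))) (b ∙ K xi) (KK K _) (Kx (dA Om _)).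
move=> d u v w z.
split=> [->|/subr0_eq e].
  by rewrite addrA subrK addrA [v + _]addrC subrK subrr.
by rewrite (addrAC u) -e addrAC addrK [v + d]addrC addrK.
Qed.

Lemma velocity_defectD xi eta :
  velocity_defect (xi + eta) = velocity_defect xi + velocity_defect eta.
Proof.
have [sD _] := can_bimod_map_ract sigmaK sinvK.
rewrite /velocity_defect (linearD K) evolveD etenDr emulDr (linearD Kx).
rewrite (linearD (nabla cO)) sD (linearD (KK K)).
by rewrite [X in _ - X = _]addrACA opprD addrACA.
Qed.

(** Applying σ⁻¹ to the correction σ(ξ ⊗ da) in ∇(ξa) leaves ξ ⊗ da, matching the term produced by
    [evolve (K xi ◁ a)]. *)
Lemma velocity_defect_ract xi (a : A) :
  velocity_defect (xi ◁ a) = velocity_defect xi ◁ a.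
Proof.
have [sD sr] := can_bimod_map_ract sigmaK sinvK.
rewrite /velocity_defect rmod_funr evolve_ract -ract_eten emul_ract elinear_ract.
rewrite nabla_ract sD sr sigmaK (linearD (KK K)) KK_ract -KK_ten.
by rewrite ractDl ractN (ractDl (Kx _)) addrA opprD addrACA subrr addr0.
Qed.

End Evolution.

Theorem proposition5p2 (R : realType) (A : algType R[i]) (Om : fodc A)
    (b : CinfA R A) (K : rmod_map Om (CinfA R A))
    (cM : lbconn (OmR R) Om (CinfA R A))
    (nabla_cM : forall c : CinfA R A,
      nabla cM c = dt ⊗ (b ∙ c + ddt c + elinear K (dA Om c)))
    (sigma_cM : forall xi : Om, sigma cM (CinfA_one R A ⊗ xi) = dt ⊗ K xi)
    (cO : lbconn Om Om Om) (sinv : Om ⨂ Om -> Om ⨂ Om)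
    (sigmaK : cancel (sigma cO) sinv) (sinvK : cancel sinv (sigma cO)) :
  [/\ (forall x : CinfA R A ⨂ Om, Dsigma (trivial_conn R) cO cM x = 0) <->
      ((forall y : Om ⨂ Om, KK K (sigma cO y) = KK K y) /\
       (forall xi : Om, velocity_eq b K cO sinv xi)),
      (forall (xi : Om) (a : A),
        velocity_eq b K cO sinv xi -> velocity_eq b K cO sinv (xi ◁ a)) &
      (forall S : Om -> Prop, right_generates S ->
        (forall xi : Om, S xi -> velocity_eq b K cO sinv xi) ->
        forall xi : Om, velocity_eq b K cO sinv xi)].
Proof.
split.
- rewrite (Dsigma_eq0 nabla_cM sigma_cM); split=> [G0|[KKs v0] xi].
    have KKs := KK_sigma G0; split=> // xi; apply/velocity_eqP.
    (* Inserting σ under K(K ⊗ id) cancels σ⁻¹, so the two defects agree. *)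
    by rewrite /velocity_defect -KKs sinvK; exact: G0.
  by have /velocity_eqP := v0 xi; rewrite /velocity_defect -KKs sinvK.
- move=> xi a /velocity_eqP v0; apply/velocity_eqP.
  by rewrite (velocity_defect_ract _ _ sigmaK sinvK) v0 ract0.
move=> S genS vS xi; have [s Ss ->] := genS xi; apply/velocity_eqP.
have vD := velocity_defectD b K sigmaK sinvK.
have v0 : velocity_defect b K cO sinv 0 = 0.
  by apply: (addrI (velocity_defect b K cO sinv 0)); rewrite -vD !addr0.
(* Additivity splits the defect over the expansion in generators; right linearity then kills each
   summand. *)
rewrite (big_morph _ vD v0) big_seq big1 // => p /Ss /vS /velocity_eqP e.
by rewrite (velocity_defect_ract _ _ sigmaK sinvK) e ract0.
Qed.
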